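(* Let $1\le p<\infty$, $m\ge1$, let $X,Y$ be Banach spaces over $\mathbb{K}$ and let $P\in\mathcal{P}(^mX;Y)$. Then $P\in\mathcal{P}_{FSt,p}(^mX;Y)$ if and only if $P^{tt}\in\Pi_p(\mathcal{P}(^mX)^*;Y^{**})$.
   Context: $\mathbb{K}=\mathbb{R}$ or $\mathbb{C}$. $\mathcal{P}(^mX;Y)$ is the space of continuous $m$-homogeneous polynomials from $X$ to $Y$, and $\mathcal{P}(^mX)=\mathcal{P}(^mX;\mathbb{K})$ with the sup norm on the unit ball of $X$. The transpose of $P$ is the continuous linear operator $P^t:Y^*\to\mathcal{P}(^mX)$, $P^t(y^* )=y^*\circ P$, and $P^{tt}:\mathcal{P}(^mX)^*\to Y^{**}$ is the (linear) transpose of $P^t$. $\Pi_p(Z;W)$ is the class of absolutely $p$-summing operators: continuous linear $u:Z\to W$ for which there is $C\ge0$ with $\left(\sum_{j=1}^N\|u(z_j)\|^p\right)^{1/p}\le C\sup_{\varphi\in B_{Z^*}}\left(\sum_{j=1}^N|\varphi(z_j)|^p\right)^{1/p}$ for all $N$ and $z_1,\dots,z_N\in Z$. $\mathcal{P}_{FSt,p}(^mX;Y)$ (factorable strongly $p$-summing polynomials) consists of those $P\in\mathcal{P}(^mX;Y)$ for which there is $C\ge0$ such that for all positive integers $m_1,m_2$, all $x_j^i\in X$ and all scalars $\lambda_j^i$ ($1\le j\le m_1$, $1\le i\le m_2$), $$\left(\sum_{j=1}^{m_1}\Big\|\sum_{i=1}^{m_2}\lambda_j^iP(x_j^i)\Big\|^p\right)^{1/p}\le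 C\sup_{q\in\mathcal{P}(^mX),\,\|q\|\le1}\left(\sum_{j=1}^{m_1}\Big|\sum_{i=1}^{m_2}\lambda_j^iq(x_j^i)\Big|^p\right)^{1/p}.$$ *)

(* Defs.v *)
From HB Require Import structures.
From mathcomp Require Import all_boot all_order all_algebra.
From mathcomp Require Import all_classical all_reals all_analysis.
From mathcomp Require Import complex.

Set Implicit Arguments.
Unset Strict Implicit.
Unset Printing Implicit Defensive.

Import Order.TTheory GRing.Theory Num.Theory.
Import numFieldNormedType.Exports.

Local Open Scope classical_set_scope.
Local Open Scope ring_scope.

Inductive scalar_kind := RealScalars | ComplexScalars.

Definition scalars (R : realType) (k : scalar_kind) : numFieldType :=
  match k with RealScalars => R | ComplexScalars => R[i] end.

(* The norm of a normed module over a field K takes its values in K; the maps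
   to_real and of_real let us view it as a real number, also when K = R[i]. *)
Definition to_real (R : realType) (k : scalar_kind) : scalars R k -> R :=
  match k return scalars R k -> R with
  | RealScalars => fun x => x
  | ComplexScalars => fun z => complex.Re z
  end.

Definition of_real (R : realType) (k : scalar_kind) : R -> scalars R k :=
  match k return R -> scalars R k with
  | RealScalars => fun x => x
  | ComplexScalars => fun x => x%:C%C
  end.

Section real_scalars.
Variables (R : realType) (k : scalar_kind).
Local Notation K := (scalars R k).
Local Notation of_real := (@of_real R k).

Lemma to_realK (z : K) : 0 <= z -> of_real (to_real z) = z.
Proof.
rewrite /of_real /to_real; case: k z => [z _ //|[a b]].
by rewrite lecE/= => /andP[/eqP -> _].
Qed.

Lemma of_realK : cancel of_real (@to_real R k).
Proof. by rewrite /of_real /to_real; case: k. Qed.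

Lemma of_realD x y : of_real (x + y) = of_real x + of_real y.
Proof. by rewrite /of_real; case: k => //=; rewrite rmorphD. Qed.

Lemma of_realM x y : of_real (x * y) = of_real x * of_real y.
Proof. by rewrite /of_real; case: k => //=; rewrite rmorphM. Qed.

Lemma of_real0 : of_real 0 = 0.
Proof. by rewrite /of_real; case: k. Qed.

Lemma of_real1 : of_real 1 = 1.
Proof. by rewrite /of_real; case: k. Qed.

Lemma ler_of_real x y : (of_real x <= of_real y) = (x <= y).
Proof. by rewrite /of_real; case: k => //=; rewrite lecR. Qed.

End real_scalars.

Definition rnorm (R : realType) (k : scalar_kind)
  (V : normedModType (scalars R k)) (x : V) : R := to_real `|x|.

Section rnorm_theory.
Variables (R : realType) (k : scalar_kind) (V : normedModType (scalars R k)).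
Implicit Types x y : V.

Lemma rnormK x : of_real k (rnorm x) = `|x|.
Proof. exact: to_realK. Qed.

Lemma rnorm_ge0 x : 0 <= rnorm x.
Proof. by rewrite -(ler_of_real k) rnormK of_real0. Qed.

Lemma rnorm0 : rnorm (0 : V) = 0.
Proof. by rewrite /rnorm normr0 -(of_real0 R k) of_realK. Qed.

Lemma rnorm0_eq0 x : rnorm x = 0 -> x = 0.
Proof. by move=> x0; apply/normr0_eq0; rewrite -rnormK x0 of_real0. Qed.

Lemma rnormD x y : rnorm (x + y) <= rnorm x + rnorm y.
Proof. by rewrite -(ler_of_real k) of_realD !rnormK ler_normD. Qed.

End rnorm_theory.

Section rnorm_scale.
Variables (R : realType) (k : scalar_kind) (V : normedModType (scalars R k)).
Implicit Types x y : V.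

Lemma rnormZ (a : scalars R k) x :
  rnorm (a *: x) = @rnorm R k (scalars R k)^o a * rnorm x.
Proof.
by apply: (can_inj (@of_realK R k)); rewrite of_realM !rnormK normrZ.
Qed.

Lemma rnorm_le x (c : R) : (rnorm x <= c) = (`|x| <= of_real k c).
Proof. by rewrite -rnormK ler_of_real. Qed.

End rnorm_scale.

Section sup_norm.
Variables (R : realType) (k : scalar_kind) (X Y : normedModType (scalars R k)).
Local Notation K := (scalars R k).

(* The supremum of the norm of f on the closed unit ball, meaningful under
   ball_bounded; it is the norm of bounded_op and of hpoly below. *)
Definition ball_norm (f : X -> Y) : R :=
  sup [set rnorm (f x) | x in [set x | rnorm x <= 1]].

Definition ball_bounded (f : X -> Y) :=
  exists M : R, forall x, rnorm x <= 1 -> rnorm (f x) <= M.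

Lemma ball_norm_ub (f : X -> Y) x :
  ball_bounded f -> rnorm x <= 1 -> rnorm (f x) <= ball_norm f.
Proof.
move=> [M fM] x1; apply: ub_le_sup; last by exists x.
by exists M => _ [y /fM yM <-].
Qed.

Lemma ball_norm_le (f : X -> Y) (c : R) :
  (forall x, rnorm x <= 1 -> rnorm (f x) <= c) -> ball_norm f <= c.
Proof.
move=> fc; apply: ge_sup; last by move=> _ [y /fc yc <-].
by exists (rnorm (f 0)), 0 => //=; rewrite rnorm0.
Qed.

Lemma ball_norm_ge0 (f : X -> Y) : ball_bounded f -> 0 <= ball_norm f.
Proof.
move=> fb; apply: le_trans (rnorm_ge0 (f 0)) _.
by apply: ball_norm_ub; rewrite ?rnorm0.
Qed.

Lemma ball_normD (f g : X -> Y) : ball_bounded f -> ball_bounded g ->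
  ball_norm (f + g) <= ball_norm f + ball_norm g.
Proof.
move=> fb gb; apply: ball_norm_le => x x1.
by apply: le_trans (rnormD _ _) _; apply: lerD; exact: ball_norm_ub.
Qed.

Lemma ball_normZ (a : K) (f : X -> Y) : ball_bounded f ->
  ball_norm (a *: f) = @rnorm R k K^o a * ball_norm f.
Proof.
have leZ (b : K) (g : X -> Y) : ball_bounded g ->
    ball_norm (b *: g) <= @rnorm R k K^o b * ball_norm g.
  move=> gb; apply: ball_norm_le => x x1.
  rewrite [(b *: g) x]/(b *: g x) rnormZ ler_wpM2l ?rnorm_ge0//.
  exact: ball_norm_ub.
move=> fb; apply/le_anti; rewrite leZ//=.
have afb : ball_bounded (a *: f).
  case: fb => M fM; exists (@rnorm R k K^o a * M) => x x1.
  by rewrite [(a *: f) x]/(a *: f x) rnormZ ler_wpM2l ?rnorm_ge0// fM.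
have [->|a0] := eqVneq a 0.
  by rewrite rnorm0 mul0r scale0r; apply: ball_norm_ge0; exists 0 => x _;
    rewrite rnorm0.
have := leZ a^-1 _ afb; rewrite scalerA mulVf// scale1r => h.
apply: le_trans (ler_wpM2l (rnorm_ge0 _) h) _.
rewrite mulrA -(rnormZ (a : K) (a^-1 : K^o)).
have -> : a *: (a^-1 : K^o) = 1 by exact: mulfV.
suff -> : @rnorm R k K^o 1 = 1 by rewrite mul1r.
by rewrite /rnorm normr1 -(of_real1 R k) of_realK.
Qed.

Definition homogeneous m (f : X -> Y) :=
  forall (c : K) x, f (c *: x) = c ^+ m *: f x.

Lemma homogeneous_ball_bounded m (f : X -> Y) :
  homogeneous m f -> {for 0, continuous f} -> ball_bounded f.
Proof.
move=> fm f0.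
have /cvgrPdist_lt/(_ 1 ltr01)/nbhs_norm0P[e /= e0 fe] : f x @[x --> 0] --> f 0.
  exact: f0.
pose d : K := e / 2.
have d0 : 0 < d by rewrite divr_gt0.
have dm0 : 0 < d ^+ m by rewrite exprn_gt0.
exists (to_real (d ^- m * (`|f 0| + 1))) => x; rewrite !rnorm_le of_real1 => x1.
rewrite to_realK; last by rewrite mulr_ge0 ?invr_ge0 ?ltW// addr_ge0.
rewrite mulrC ler_pdivlMr// -[d ^+ m]gtr0_norm// mulrC -normrZ -fm.
have /fe h : `|d *: x| < e.
  rewrite normrZ gtr0_norm//; apply: (@le_lt_trans _ _ d).
    by rewrite ler_piMr// ltW.
  by rewrite /d ltr_pdivrMr// ltr_pMr// ltr1n.
rewrite -[f (d *: x)](subrK (f 0)) addrC.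
by apply: le_trans (ler_normD _ _) _; rewrite lerD2l distrC ltW.
Qed.

Lemma ball_norm_homogeneous m (f : X -> Y) x : homogeneous m f ->
  ball_bounded f -> rnorm (f x) <= ball_norm f * rnorm x ^+ m.
Proof.
move=> fm fb.
have [x0|x0] := eqVneq x 0.
  case: m fm => [|m] fm.
    rewrite expr0 mulr1 x0; apply: ball_norm_ub => //; by rewrite rnorm0.
  have -> : f x = 0 by have := fm 0 x; rewrite x0 scaler0 expr0n/= scale0r.
  by rewrite rnorm0 mulr_ge0 ?ball_norm_ge0 ?exprn_ge0 ?rnorm_ge0.
have nx0 : 0 < `|x| by rewrite normr_gt0.
rewrite -(ler_of_real k) of_realM.
have -> : of_real k (rnorm x ^+ m) = `|x| ^+ m.
  elim: m {fm} => [|n IH]; first by rewrite !expr0 of_real1.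
  by rewrite !exprS of_realM IH rnormK.
rewrite rnormK -ler_pdivrMr ?exprn_gt0// mulrC.
rewrite -[_^-1]gtr0_norm ?invr_gt0 ?exprn_gt0// -normrZ -exprVn -fm -rnorm_le.
apply: ball_norm_ub => //.
by rewrite rnorm_le of_real1 normrZ gtr0_norm ?invr_gt0// mulVf// gt_eqF.
Qed.

Lemma ball_norm_eq0 m (f : X -> Y) : homogeneous m f -> ball_bounded f ->
  ball_norm f = 0 -> f = 0.
Proof.
move=> fm fb f0; apply/funext => x; apply: rnorm0_eq0; apply/le_anti.
by rewrite rnorm_ge0 andbT; have := ball_norm_homogeneous x fm fb;
  rewrite f0 mul0r.
Qed.

End sup_norm.

Section bounded_op.
Variables (R : realType) (k : scalar_kind) (X Y : normedModType (scalars R k)).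
Local Notation K := (scalars R k).

Definition is_bounded_op (f : X -> Y) : Prop := linear f /\ continuous f.

Definition bounded_op_pred : {pred X -> Y} := [pred f | `[< is_bounded_op f >]].

Record bounded_op : Type := BoundedOp {
  bounded_op_fun :> X -> Y;
  bounded_opP : bounded_op_fun \in bounded_op_pred
}.

HB.instance Definition _ := [isSub for bounded_op_fun].
HB.instance Definition _ := [Choice of bounded_op by <:].

Lemma bounded_op_submod_closed : submod_closed bounded_op_pred.
Proof.
split=> [|a f g]; first by apply/asboolP; split=> [b x y|x];
  [rewrite /GRing.zero/= scaler0 addr0|exact: cst_continuous].
move=> /asboolP[lf cf] /asboolP[lg cg]; apply/asboolP; split.
  have fgE z : (a *: f + g) z = a *: f z + g z by [].
  by move=> b x y; rewrite !fgE lf lg !scalerDr !scalerA (mulrC a b) addrACA.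
by move=> x; apply: cvgD; [apply: cvgZr; exact: cf|exact: cg].
Qed.

HB.instance Definition _ :=
  GRing.isSubmodClosed.Build K (X -> Y) bounded_op_pred bounded_op_submod_closed.
HB.instance Definition _ := [SubChoice_isSubLmodule of bounded_op by <:].

Lemma bounded_op_linear (u : bounded_op) : linear u.
Proof. by case: u => f /= /asboolP[]. Qed.

HB.instance Definition _ (u : bounded_op) :=
  GRing.isLinear.Build K X Y _ u (bounded_op_linear u).

Lemma bounded_op_continuous (u : bounded_op) : continuous u.
Proof. by case: u => f /= /asboolP[]. Qed.

Lemma bounded_op_homogeneous (u : bounded_op) : homogeneous 1 u.
Proof. by move=> c x; rewrite expr1 linearZ. Qed.

Lemma bounded_op_bounded (u : bounded_op) : ball_bounded u.
Proof.
exact: homogeneous_ball_bounded (bounded_op_homogeneous u)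
  (@bounded_op_continuous u 0).
Qed.

Definition bounded_op_norm (u : bounded_op) : K := of_real k (ball_norm u).

Lemma bounded_op_normD (u v : bounded_op) :
  bounded_op_norm (u + v) <= bounded_op_norm u + bounded_op_norm v.
Proof.
by rewrite -of_realD ler_of_real ball_normD//; exact: bounded_op_bounded.
Qed.

Lemma bounded_op_normZ (a : K) (u : bounded_op) :
  bounded_op_norm (a *: u) = `|a| * bounded_op_norm u.
Proof.
rewrite /bounded_op_norm [ball_norm _]ball_normZ ?of_realM//.
  by rewrite (@rnormK R k K^o).
exact: bounded_op_bounded.
Qed.

Lemma bounded_op_norm_eq0 (u : bounded_op) : bounded_op_norm u = 0 -> u = 0.
Proof.
move=> /(congr1 (@to_real R k)); rewrite of_realK -(of_real0 R k) of_realK => u0.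
apply/val_inj; apply: ball_norm_eq0 u0; first exact: bounded_op_homogeneous.
exact: bounded_op_bounded.
Qed.

HB.instance Definition _ := @Lmodule_isNormed.Build K bounded_op
  bounded_op_norm bounded_op_normD bounded_op_normZ bounded_op_norm_eq0.

End bounded_op.

Definition dual (R : realType) (k : scalar_kind)
  (X : normedModType (scalars R k)) : normedModType (scalars R k) :=
  bounded_op X (scalars R k)^o.

Section hpoly.
Variables (R : realType) (k : scalar_kind) (m : nat).
Variables (X Y : normedModType (scalars R k)).
Local Notation K := (scalars R k).

(* dfwith v i x is v with its i-th component replaced by x. *)
Definition multilinear_map (A : ('I_m -> X) -> Y) : Prop :=
  forall (i : 'I_m) (v : 'I_m -> X), linear (fun x : X => A (dfwith v i x)).

(* A continuous m-homogeneous polynomial is a continuous map which is the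
   restriction to the diagonal of an m-linear map, not assumed symmetric. *)
Definition is_hpoly (f : X -> Y) : Prop :=
  (exists2 A : ('I_m -> X) -> Y,
     multilinear_map A & forall x, f x = A (fun=> x)) /\ continuous f.

Definition hpoly_pred : {pred X -> Y} := [pred f | `[< is_hpoly f >]].

Record hpoly : Type := HPoly {
  hpoly_fun :> X -> Y;
  hpolyP : hpoly_fun \in hpoly_pred
}.

HB.instance Definition _ := [isSub for hpoly_fun].
HB.instance Definition _ := [Choice of hpoly by <:].

Lemma hpoly_submod_closed : submod_closed hpoly_pred.
Proof.
split=> [|a f g].
  apply/asboolP; split; last by move=> x; exact: cst_continuous.
  by exists (fun=> 0) => // i v b x y /=; rewrite scaler0 addr0.
move=> /asboolP[[A lA fA] cf] /asboolP[[B lB gB] cg]; apply/asboolP; split.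
  exists (fun v => a *: A v + B v); last first.
    by move=> x; rewrite [LHS]/(a *: f x + g x) fA gB.
  by move=> i v b x y /=; rewrite lA lB !scalerDr !scalerA (mulrC a b) addrACA.
by move=> x; apply: cvgD; [apply: cvgZr; exact: cf|exact: cg].
Qed.

HB.instance Definition _ :=
  GRing.isSubmodClosed.Build K (X -> Y) hpoly_pred hpoly_submod_closed.
HB.instance Definition _ := [SubChoice_isSubLmodule of hpoly by <:].

Lemma hpoly_continuous (P : hpoly) : continuous P.
Proof. by case: P => f /= /asboolP[]. Qed.

Lemma hpoly_homogeneous (P : hpoly) : homogeneous m P.
Proof.
case: P => f /= /asboolP[[A lA fA] _] c x; rewrite !fA.
pose w n := fun j : 'I_m => if (j < n)%N then c *: x else x.
suff wE n : (n <= m)%N -> A (w n) = c ^+ n *: A (w 0).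
  have <- : w m = (fun=> c *: x) by apply/funext => j; rewrite /w ltn_ord.
  exact: wE.
elim: n => [_|n IH nm]; first by rewrite expr0 scale1r.
have AZ (i : 'I_m) (v : 'I_m -> X) (z : X) : A (dfwith v i (c *: z)) = c *: A (dfwith v i z).
  have h0 : A (dfwith v i 0) = 0.
    have := lA i v 1 0 0; rewrite /= !scale1r addr0 => /eqP.
    by rewrite -subr_eq subrr => /eqP.
  by have := lA i v c z 0; rewrite /= addr0 h0 addr0.
pose i := Ordinal nm.
have -> : w n.+1 = dfwith (w n) i (c *: x).
  apply/funext => j; have [<-|ij] := eqVneq i j; first by
    rewrite dfwithin /w/= ltnSn.
  rewrite dfwithout// /w ltnS leq_eqVlt.
  by rewrite (_ : (j == n :> nat) = false)//; apply/negbTE; rewrite eq_sym.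
have wi : dfwith (w n) i x = w n; last first.
  by rewrite AZ wi IH 1?ltnW// scalerA -exprS.
apply/funext => j; have [<-|ij] := eqVneq i j; last by rewrite dfwithout.
by rewrite dfwithin /w/= ltnn.
Qed.

Lemma hpoly_bounded (P : hpoly) : ball_bounded P.
Proof.
exact: homogeneous_ball_bounded (hpoly_homogeneous P) (@hpoly_continuous P 0).
Qed.

Definition hpoly_norm (P : hpoly) : K := of_real k (ball_norm P).

Lemma hpoly_normD (P Q : hpoly) :
  hpoly_norm (P + Q) <= hpoly_norm P + hpoly_norm Q.
Proof. by rewrite -of_realD ler_of_real ball_normD//; exact: hpoly_bounded. Qed.

Lemma hpoly_normZ (a : K) (P : hpoly) :
  hpoly_norm (a *: P) = `|a| * hpoly_norm P.
Proof.
rewrite /hpoly_norm [ball_norm _]ball_normZ ?of_realM//.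
  by rewrite (@rnormK R k K^o).
exact: hpoly_bounded.
Qed.

Lemma hpoly_norm_eq0 (P : hpoly) : hpoly_norm P = 0 -> P = 0.
Proof.
move=> /(congr1 (@to_real R k)); rewrite of_realK -(of_real0 R k) of_realK => P0.
apply/val_inj; apply: ball_norm_eq0 P0; first exact: hpoly_homogeneous.
exact: hpoly_bounded.
Qed.

HB.instance Definition _ := @Lmodule_isNormed.Build K hpoly
  hpoly_norm hpoly_normD hpoly_normZ hpoly_norm_eq0.

End hpoly.

Definition scalar_hpoly (R : realType) (k : scalar_kind) (m : nat)
  (X : normedModType (scalars R k)) : normedModType (scalars R k) :=
  hpoly m X (scalars R k)^o.

(* transpose u is psi |-> psi \o u for a bounded operator u, poly_transpose P is
   psi |-> psi \o P for a continuous polynomial P. *)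
Section transpose.
Variables (R : realType) (k : scalar_kind).
Local Notation K := (scalars R k).

Lemma linear_ball_continuous (V W : normedModType K) (f : {linear V -> W})
  (C : R) : (forall x, rnorm (f x) <= C * rnorm x) -> continuous f.
Proof.
move=> fC; apply: bounded_linear_continuous; apply/linear_boundedP.
have C0 : 0 <= `|C| by [].
exists (of_real k `|C|); split.
  by apply: ger0_real; rewrite -(of_real0 R k) ler_of_real.
move=> r Cr x; apply: le_trans (_ : of_real k `|C| * `|x| <= _).
  rewrite -!rnormK -of_realM ler_of_real; apply: le_trans (fC x) _.
  by rewrite ler_wpM2r ?rnorm_ge0 ?ler_norm.
by rewrite ler_wpM2r// ltW.
Qed.


Lemma rnorm_op (V W : normedModType K) (u : bounded_op V W) :
  rnorm u = ball_norm u.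
Proof. exact: of_realK. Qed.

Lemma rnorm_hpoly m (V W : normedModType K) (P : hpoly m V W) :
  rnorm P = ball_norm P.
Proof. exact: of_realK. Qed.

Lemma rnorm_op_le (V W : normedModType K) (u : bounded_op V W) x :
  rnorm (u x) <= rnorm u * rnorm x.
Proof.
have := ball_norm_homogeneous x (bounded_op_homogeneous u)
  (@bounded_op_bounded _ _ _ _ u).
by rewrite expr1 rnorm_op.
Qed.

Section operator.
Variables (Z W : normedModType K) (u : bounded_op Z W).

Lemma is_bounded_op_comp (psi : dual W) :
  (psi \o u : Z -> K^o) \in @bounded_op_pred R k Z K^o.
Proof.
apply/asboolP; split; first by move=> a x y /=; rewrite !linearP.
move=> x; apply: continuous_comp; first exact: bounded_op_continuous.
exact: bounded_op_continuous.
Qed.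

Definition transpose_fun (psi : dual W) : dual Z :=
  BoundedOp (is_bounded_op_comp psi).

Lemma transpose_fun_linear : linear transpose_fun.
Proof. by move=> a f g; apply/val_inj/funext. Qed.

HB.instance Definition _ := GRing.isLinear.Build K (dual W) (dual Z) _
  transpose_fun transpose_fun_linear.

Lemma is_bounded_op_transpose : transpose_fun \in @bounded_op_pred R k (dual W) (dual Z).
Proof.
apply/asboolP; split; first exact: transpose_fun_linear.
apply: (@linear_ball_continuous _ _ transpose_fun (rnorm u)) => psi.
rewrite [leLHS]rnorm_op; apply: ball_norm_le => x x1 /=.
apply: le_trans (rnorm_op_le psi (u x)) _.
rewrite mulrC ler_wpM2r ?rnorm_ge0//; apply: le_trans (rnorm_op_le u x) _.
by rewrite ler_piMr ?rnorm_ge0.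
Qed.

Definition transpose : bounded_op (dual W) (dual Z) :=
  BoundedOp is_bounded_op_transpose.

End operator.

Section polynomial.
Variables (m : nat) (X Y : normedModType K) (P : hpoly m X Y).

Lemma is_hpoly_comp (psi : dual Y) :
  (psi \o P : X -> K^o) \in @hpoly_pred R k m X K^o.
Proof.
case: P => f fP; have /asboolP[[A lA fA] cf] := fP; apply/asboolP; split.
  exists (psi \o A) => [i v a x y|x] /=; last by rewrite fA.
  by rewrite (lA i v a x y) linearP.
move=> x; apply: continuous_comp; first exact: cf.
exact: bounded_op_continuous.
Qed.

Definition poly_transpose_fun (psi : dual Y) : scalar_hpoly m X :=
  HPoly (is_hpoly_comp psi).

Lemma poly_transpose_fun_linear : linear poly_transpose_fun.
Proof. by move=> a f g; apply/val_inj/funext. Qed.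

HB.instance Definition _ := GRing.isLinear.Build K (dual Y) (scalar_hpoly m X) _
  poly_transpose_fun poly_transpose_fun_linear.

Lemma is_bounded_op_poly_transpose :
  poly_transpose_fun \in @bounded_op_pred R k (dual Y) (scalar_hpoly m X).
Proof.
apply/asboolP; split; first exact: poly_transpose_fun_linear.
apply: (@linear_ball_continuous _ _ poly_transpose_fun (rnorm P)) => psi.
rewrite [leLHS]rnorm_hpoly; apply: ball_norm_le => x x1 /=.
apply: le_trans (rnorm_op_le psi (P x)) _.
rewrite mulrC ler_wpM2r ?rnorm_ge0// rnorm_hpoly ball_norm_ub//.
exact: hpoly_bounded.
Qed.

Definition poly_transpose : bounded_op (dual Y) (scalar_hpoly m X) :=
  BoundedOp is_bounded_op_poly_transpose.

End polynomial.

End transpose.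

Section summing.
Variables (R : realType) (k : scalar_kind) (p : R).
Local Notation K := (scalars R k).

Definition absolutely_summing (Z W : normedModType K) (u : bounded_op Z W) :=
  exists2 C : R, 0 <= C &
    forall (N : nat) (z : 'I_N -> Z),
      (\sum_(j < N) rnorm (u (z j)) `^ p) `^ p^-1 <=
      C * sup [set (\sum_(j < N) rnorm (phi (z j)) `^ p) `^ p^-1 |
                 phi in [set phi : dual Z | rnorm phi <= 1]].

Definition factorable_strongly_summing (m : nat) (X Y : normedModType K)
    (P : hpoly m X Y) :=
  exists2 C : R, 0 <= C &
    forall (m1 m2 : nat), (0 < m1)%N -> (0 < m2)%N ->
    forall (x : 'I_m1 -> 'I_m2 -> X) (lambda : 'I_m1 -> 'I_m2 -> K),
      (\sum_(j < m1) rnorm (\sum_(i < m2) lambda j i *: P (x j i)) `^ p)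
        `^ p^-1 <=
      C * sup [set (\sum_(j < m1)
                      rnorm (\sum_(i < m2) lambda j i *: q (x j i)) `^ p)
                        `^ p^-1 |
                 q in [set q : scalar_hpoly m X | rnorm q <= 1]].

End summing.

(* Main.v *)
From HB Require Import structures.
Require Import Defs.
From mathcomp Require Import all_boot all_order all_algebra.
From mathcomp Require Import all_classical all_reals all_analysis.
From mathcomp Require Import complex lra.

Set Implicit Arguments.
Unset Strict Implicit.
Unset Printing Implicit Defensive.

Import Order.TTheory GRing.Theory Num.Theory.
Import numFieldNormedType.Exports.

Local Open Scope classical_set_scope.
Local Open Scope ring_scope.

(** Write Z' for the dual of a space Z, Q for the space of m-homogeneous
    polynomials on X and delta_x in Q' for the evaluation at x. The bitranspose of
    P maps delta_x to P x, seen in Y''. The condition on P therefore says that the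
    bitranspose satisfies the summing inequality for families of combinations of evaluations, the weak norm being
    computed with the unit ball of Q instead of that of Q''. Both directions
    compare this with the summing inequality for arbitrary families (z_j) in Q'.

    The two weak norms agree ([weak_lpnorm_bidual]): if the scalars a_j are
    norming for (phi (z_j)) in ell_p, then the ell_p norm of (phi (z_j)) is
    phi (sum a_j z_j), which is at most the norm of sum a_j z_j, which is computed
    on Q. With the isometric embedding of Y in Y'' (Hahn-Banach), this shows that
    P is factorable strongly p-summing when its bitranspose is p-summing.

    For the converse the inequality has to be carried from the span E of the
    evaluations to Q'. Functionals psi_j in the unit ball of Y' which almost norm
    the images of the z_j, and norming scalars b_j, reduce it to a bound for
    |sum_j z_j (q_j)| by the weak norm of (z_j), where q_j = b_j (psi_j o P) is
    fixed; the hypothesis on P is this bound for families (e_j) in E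
    ([eval_comb_bound_bidual] is the passage from E to Q'). Finitely many
    functionals a_i, i in J, of the unit ball of the dual of ell_p^n determine the
    norm of ell_p^n up to a factor 2, so (e_j) |-> (sum_j a_ij e_j)_i embeds E^n
    with its weak norm in the J-fold sup-sum of Q'. The functional
    (e_j) |-> sum_j e_j (q_j) extends to this sum by Hahn-Banach, and its
    components, restricted to the evaluations, are polynomials G_i in Q such that
    the sum of their norms is controlled. Then q_j = sum_i a_ij G_i, so
    sum_j z_j (q_j) = sum_i (sum_j a_ij z_j) (G_i), where every
    sum_j a_ij z_j is bounded by the weak norm of (z_j).

    The restriction to the evaluations of a functional on Q' is an element of Q
    ([bidual_hpoly]), that is, E' = Q: by polarization delta is the diagonal of an
    m-linear map with values in Q', and local boundedness gives continuity. *)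

(** * Finite-dimensional ell_p norms *)

Section real_lp.
Variables (R : realType) (p : R) (I : finType).
Hypothesis p1 : 1 <= p.
Implicit Types r s t : I -> R.

(** The ell_p norm of a family of nonnegative reals. *)
Definition lpnorm r : R := (\sum_j r j `^ p) `^ p^-1.

Let p0 : 0 < p. Proof. exact: lt_le_trans p1. Qed.

Lemma lpnorm_ge0 r : 0 <= lpnorm r. Proof. exact: powR_ge0. Qed.

Lemma lpsum_ge0 r : 0 <= \sum_j r j `^ p.
Proof. by apply: sumr_ge0 => j _; exact: powR_ge0. Qed.

Lemma lpnorm_powR r : lpnorm r `^ p = \sum_j r j `^ p.
Proof.
by rewrite /lpnorm -powRrM mulVf ?gt_eqF// powRr1// lpsum_ge0.
Qed.

Lemma ler_lpnorm r s : (forall j, 0 <= r j) -> (forall j, r j <= s j) ->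
  lpnorm r <= lpnorm s.
Proof.
move=> r0 rs; apply: ge0_ler_powR; rewrite ?nnegrE ?lpsum_ge0 ?invr_ge0 ?(ltW p0)//.
apply: ler_sum => j _; apply: ge0_ler_powR; rewrite ?nnegrE ?(ltW p0)//.
exact: le_trans (rs j).
Qed.

Lemma le_lpnorm r j : (forall j, 0 <= r j) -> r j <= lpnorm r.
Proof.
move=> r0; rewrite -[leLHS]powRr1// -[X in _ `^ X](mulfV (lt0r_neq0 p0)) powRrM.
apply: ge0_ler_powR; rewrite ?nnegrE ?lpsum_ge0 ?invr_ge0 ?powR_ge0 ?(ltW p0)//.
by rewrite (bigD1 j)//= ler_wpDr// sumr_ge0// => i _; exact: powR_ge0.
Qed.

Lemma lpnormZ (c : R) r : 0 <= c -> (forall j, 0 <= r j) ->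
  lpnorm (fun j => c * r j) = c * lpnorm r.
Proof.
move=> c0 r0; rewrite /lpnorm.
under eq_bigr do rewrite powRM//.
rewrite -mulr_sumr powRM ?powR_ge0 ?lpsum_ge0// -powRrM mulfV ?gt_eqF//.
by rewrite powRr1.
Qed.

Lemma young_powR (s t : R) : 0 <= s -> 0 <= t ->
  s `^ (p - 1) * t <= (1 - p^-1) * s `^ p + p^-1 * t `^ p.
Proof.
move=> s0 t0; have [p_1|pn1] := eqVneq p 1.
  by rewrite p_1 subrr invr1 subrr mul0r add0r mul1r powRr0 mul1r powRr1.
have q0 : 0 < p - 1 by rewrite subr_gt0 lt_neqAle eq_sym pn1.
have pE : p^-1 + (p / (p - 1))^-1 = 1.
  by rewrite invf_div mulrBl mulfV ?gt_eqF// mul1r subrKC.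
have h := @conjugate_powR R (s `^ (p - 1)) t (p / (p - 1)) p (powR_ge0 _ _) t0
  (divr_gt0 p0 q0) p0.
have /h : (p / (p - 1))^-1 + p^-1 = 1 by rewrite addrC.
have -> : (s `^ (p - 1)) `^ (p / (p - 1)) = s `^ p.
  by rewrite -powRrM mulrCA mulfV ?mulr1// gt_eqF.
have -> : 1 - p^-1 = (p / (p - 1))^-1 by apply/eqP; rewrite subr_eq addrC pE.
by rewrite [_^-1 * s `^ p]mulrC [p^-1 * _]mulrC.
Qed.

(** The reverse of Hoelder's inequality: [lpnorm r] is the maximum of the
    pairings of [r] with the functionals of norm at most 1, and is attained at
    the normalisation of [r `^ (p - 1)]. *)
Lemma lpnorm_dual r : (forall j, 0 <= r j) ->
  exists a : I -> R, [/\ forall j, 0 <= a j,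
    forall t, (forall j, 0 <= t j) -> \sum_j a j * t j <= lpnorm t &
    \sum_j a j * r j = lpnorm r].
Proof.
move=> r0; have [L0|L0] := eqVneq (lpnorm r) 0.
  exists (fun=> 0); split => // [t t0|]; last first.
    by rewrite L0 big1// => j _; rewrite mul0r.
  by rewrite big1 ?lpnorm_ge0// => j _; rewrite mul0r.
have {}L0 : 0 < lpnorm r by rewrite lt_def L0 lpnorm_ge0.
have normalized t : (forall j, 0 <= t j) -> 0 < lpnorm t ->
    \sum_j (t j / lpnorm t) `^ p = 1.
  move=> t0 M0; under eq_bigr do rewrite powRM ?invr_ge0 ?(ltW M0)//.
  rewrite -mulr_suml -lpnorm_powR -powRM ?invr_ge0 ?(ltW M0)//.
  by rewrite mulfV ?gt_eqF// powR1.
pose s j := r j / lpnorm r.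
have s0 j : 0 <= s j by rewrite divr_ge0// ltW.
exists (fun j => s j `^ (p - 1)); split => [j|t t0|]; first exact: powR_ge0.
- have [M0|M0] := eqVneq (lpnorm t) 0.
    rewrite M0 big1// => j _; have := le_lpnorm j t0; rewrite M0 => tj.
    by rewrite (_ : t j = 0) ?mulr0//; apply/le_anti; rewrite tj t0.
  have {}M0 : 0 < lpnorm t by rewrite lt_def M0 lpnorm_ge0.
  rewrite -[leRHS]mul1r -ler_pdivrMr// mulr_suml.
  apply: (@le_trans _ _ (\sum_j ((1 - p^-1) * s j `^ p +
                                  p^-1 * (t j / lpnorm t) `^ p))).
    apply: ler_sum => j _; rewrite -mulrA.
    exact: young_powR (s0 j) (divr_ge0 (t0 j) (ltW M0)).
  rewrite big_split/= -[X in X + _]mulr_sumr -[X in _ + X]mulr_sumr.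
  rewrite [X in _ * X + _](normalized r r0 L0).
  rewrite [X in _ + _ * X](normalized t t0 M0).
  by rewrite !mulr1 subrK.
- have rE j : r j = s j * lpnorm r by rewrite /s divfK ?gt_eqF.
  under eq_bigr do rewrite [X in _ * X]rE mulrA [X in X * _]mulrC mulr_powRB1//.
  by rewrite -mulr_suml normalized// mul1r.
Qed.

Lemma lpnormD s t : (forall j, 0 <= s j) -> (forall j, 0 <= t j) ->
  lpnorm (fun j => s j + t j) <= lpnorm s + lpnorm t.
Proof.
move=> s0 t0.
have [|a [a0 ale <-]] := @lpnorm_dual (fun j => s j + t j).
  by move=> j; rewrite addr_ge0.
under eq_bigr do rewrite mulrDr.
by rewrite big_split/= lerD// ale.
Qed.

Lemma lpnorm_le_sum t : (forall j, 0 <= t j) -> lpnorm t <= \sum_j t j.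
Proof.
move=> t0; have [a [a0 ale <-]] := lpnorm_dual t0.
apply: ler_sum => j _; rewrite ler_piMl//.
have := ale (fun i => (i == j)%:R) (fun i => ler0n _ _).
rewrite (bigD1 j)//= eqxx mulr1 big1 ?addr0; last first.
  by move=> i /negbTE ->; rewrite mulr0.
move/le_trans; apply; rewrite /lpnorm (bigD1 j)//= eqxx powR1 big1 ?addr0 ?powR1//.
by move=> i /negbTE ->; rewrite powR0 ?gt_eqF.
Qed.

End real_lp.

(** * Norming scalars and finite nets *)

Section scalar_lp.
Variables (R : realType) (k : scalar_kind).
Local Notation K := (scalars R k).
Local Notation mag := (@rnorm R k K^o).

Lemma of_real_inj : injective (@of_real R k).
Proof. exact: can_inj (@of_realK R k). Qed.

Lemma of_real_sum (I : Type) (r : seq I) (P : pred I) (F : I -> R) :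
  of_real k (\sum_(i <- r | P i) F i) = \sum_(i <- r | P i) of_real k (F i).
Proof. by apply: big_morph; [exact: of_realD|exact: of_real0]. Qed.

Lemma magM (a b : K) : mag (a * b) = mag a * mag b.
Proof. exact: (rnormZ a (b : K^o)). Qed.

Lemma mag_of_real (r : R) : 0 <= r -> mag (of_real k r) = r.
Proof.
move=> r0; apply: of_real_inj; rewrite rnormK ger0_norm//.
by rewrite -(of_real0 R k) ler_of_real.
Qed.

Lemma rnormN (V : normedModType K) (x : V) : rnorm (- x) = rnorm x.
Proof. by rewrite /rnorm normrN. Qed.

Lemma magB (a b : K) : mag (a - b) <= mag a + mag b.
Proof. by rewrite -[mag b](@rnormN K^o); exact: (@rnormD R k K^o). Qed.

Lemma rnorm_sum (V : normedModType K) (I : Type) (r : seq I) (P : pred I)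
    (F : I -> V) :
  rnorm (\sum_(i <- r | P i) F i) <= \sum_(i <- r | P i) rnorm (F i).
Proof.
elim/big_ind2: _ => [|x a y b xa yb|//]; first by rewrite rnorm0.
exact: le_trans (rnormD _ _) (lerD xa yb).
Qed.

Lemma exists_phase (c : K) :
  exists2 u : K, mag u <= 1 & u * c = of_real k (mag c).
Proof.
rewrite rnormK; have [->|c0] := eqVneq c 0.
  by exists 0; rewrite ?rnorm0// mulr0 normr0.
exists (`|c| / c); last by rewrite divfK.
rewrite rnorm_le of_real1 normrM normr_id normfV.
by rewrite [leLHS]mulfV// normr_eq0.
Qed.

Lemma real_ball_totally_bounded (e : R) : 0 < e ->
  exists s : seq R, forall t, `|t| <= 1 -> exists2 u, u \in s & `|t - u| <= e.
Proof.
move=> e0; pose n := (Num.trunc e^-1).+1.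
have n0 : 0 < n%:R :> R by rewrite ltr0n.
have ne : n%:R^-1 <= e.
  rewrite -[leRHS]invrK lef_pV2 ?posrE ?invr_gt0//.
  by apply/ltW; exact: truncnS_gt.
exists [seq i%:R / n%:R - 1 | i <- iota 0 (2 * n).+1] => t.
rewrite ler_norml => /andP[t1 t2].
have t0 : 0 <= (t + 1) * n%:R by rewrite mulr_ge0 ?(ltW n0)//; lra.
pose i := Num.trunc ((t + 1) * n%:R).
have /andP[i1 i2] : i%:R <= (t + 1) * n%:R < i.+1%:R by exact: truncn_itv.
exists (i%:R / n%:R - 1).
  apply/mapP; exists i => //; rewrite mem_iota/= add0n ltnS.
  rewrite -(ler_nat R) (le_trans i1)// natrM ler_wpM2r ?(ltW n0)//; lra.
rewrite opprB addrA -[t + 1](mulfK (lt0r_neq0 n0)) -mulrBl normrM.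
rewrite (ger0_norm (_ : 0 <= n%:R^-1)) ?invr_ge0 ?(ltW n0)//.
apply: le_trans ne; rewrite ler_piMl ?invr_ge0 ?(ltW n0)//.
by rewrite ger0_norm ?subr_ge0// lerBlDr [leRHS]addrC natr1 ltW.
Qed.

End scalar_lp.

Lemma scalar_ball_totally_bounded (R : realType) (k : scalar_kind) (e : R) :
  0 < e -> exists s : seq (scalars R k),
    forall t, @rnorm R k (scalars R k)^o t <= 1 ->
      exists2 u, u \in s & @rnorm R k (scalars R k)^o (t - u) <= e.
Proof.
case: k => e0; first exact: real_ball_totally_bounded.
have /real_ball_totally_bounded[s sP] : 0 < e / 2 by rewrite divr_gt0.
exists [seq (x +i* y)%C | x <- s, y <- s] => -[a b] ab1.
have {ab1} : Num.sqrt (a ^+ 2 + b ^+ 2) <= 1 by [].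
rewrite -[X in _ <= X]sqrtr1 ler_sqrt// => ab1.
have /sP[x xs ax] : `|a| <= 1.
  rewrite -(@ler_pXn2r _ 2)// ?nnegrE// expr1n real_normK ?num_real//.
  by apply: le_trans ab1; rewrite lerDl sqr_ge0.
have /sP[y ys bx] : `|b| <= 1.
  rewrite -(@ler_pXn2r _ 2)// ?nnegrE// expr1n real_normK ?num_real//.
  by apply: le_trans ab1; rewrite lerDr sqr_ge0.
exists (x +i* y)%C; first by apply/allpairsP; exists (x, y).
have -> : @rnorm R ComplexScalars (scalars R ComplexScalars)^o
  ((a +i* b)%C - (x +i* y)%C) = Num.sqrt ((a - x) ^+ 2 + (b - y) ^+ 2) by [].
rewrite -[leRHS]ger0_norm ?(ltW e0)// -sqrtr_sqr ler_wsqrtr//.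
rewrite -[(a - x) ^+ 2]real_normK ?num_real// -[(b - y) ^+ 2]real_normK ?num_real//.
have := normr_ge0 (a - x); have := normr_ge0 (b - y); nra.
Qed.

Section scalar_lp_norming.
Variables (R : realType) (k : scalar_kind) (p : R) (I : finType).
Hypothesis p1 : 1 <= p.
Local Notation K := (scalars R k).
Local Notation mag := (@rnorm R k K^o).
Implicit Types s t : I -> K.

Let lp t := lpnorm p (fun j => mag (t j)).

Lemma lpnorm_norming s : exists2 a : I -> K,
  forall t, mag (\sum_j a j * t j) <= lp t &
  \sum_j a j * s j = of_real k (lp s).
Proof.
have [b [b0 ble bs]] := @lpnorm_dual _ p I p1 _ (fun j => rnorm_ge0 (s j : K^o)).
have [u up] := choice (fun j => (exists2P _ _).1 (exists_phase (s j))).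
exists (fun j => of_real k (b j) * u j) => [t|].
  apply: le_trans (ble _ (fun j => rnorm_ge0 (t j : K^o))).
  apply: le_trans (rnorm_sum _ _ _) _; apply: ler_sum => j _.
  rewrite !magM mag_of_real// ler_wpM2r ?rnorm_ge0// ler_piMr//.
  by case: (up j).
rewrite /lp -bs of_real_sum; apply: eq_bigr => j _.
by rewrite of_realM -mulrA; case: (up j) => _ ->.
Qed.

(** The norm of ell_p^I is equivalent to a maximum of finitely many functionals,
    with a constant which does not depend on the dimension: take norming
    functionals at the points of a fine net of the unit ball. *)
Lemma lpnorm_finite_norming : exists (J : finType) (a : J -> I -> K),
  (forall i t, mag (\sum_j a i j * t j) <= lp t) /\
  (forall t, exists i, lp t <= 2 * mag (\sum_j a i j * t j)).
Proof.
have quarters (x y z w : R) :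
    x <= y + z -> z <= 4^-1 -> y <= w + z -> x <= 2^-1 + w.
  by move=> *; lra.
have half (x : R) : 1 <= 2^-1 + x -> 2^-1 <= x by move=> *; lra.
pose e : R := (4 * #|I|.+1%:R)^-1.
have e0 : 0 < e by rewrite invr_gt0 mulr_gt0.
have [s sP] := @scalar_ball_totally_bounded R k e e0.
have [a aP] := choice (fun f : {ffun I -> seq_sub s} =>
  (exists2P _ _).1 (lpnorm_norming (fun j => ssval (f j)))).
exists {ffun I -> seq_sub s}, a; split=> [i|t]; first by case: (aP i).
have lp0 : 0 <= lp t by exact: lpnorm_ge0.
(* For [lp t = 0] this is the zero family, as the inverse of 0 is 0. *)
pose t' j := of_real k (lp t)^-1 * t j.
have t'1 j : mag (t' j) <= 1.
  rewrite magM mag_of_real ?invr_ge0//.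
  have := @le_lpnorm _ p I p1 _ j (fun j => rnorm_ge0 (t j : K^o)).
  rewrite -/(lp t); have [->|tn0] := eqVneq (lp t) 0.
    by rewrite invr0 mul0r.
  by rewrite mulrC ler_pdivrMr ?mul1r// lt_def tn0.
have [u up] := choice (fun j => (exists2P _ _).1 (sP _ (t'1 j))).
pose f : {ffun I -> seq_sub s} := [ffun j => SeqSub (up j).1].
have lpB : lp (fun j => t' j - u j) <= 4^-1.
  apply: le_trans (lpnorm_le_sum p1 _) _; first by move=> j; exact: rnorm_ge0.
  apply: (@le_trans _ _ (\sum_(j : I) e)).
    by apply: ler_sum => j _; case: (up j).
  rewrite sumr_const -[e *+ _]mulr_natr /e invfM -mulrA ler_piMr ?invr_ge0//.
  by rewrite mulrC ler_pdivrMr ?ltr0n// mul1r ler_nat.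
exists f; have [ale au] := aP f.
have fE : (fun j => ssval (f j)) = u by apply/funext => j; rewrite ffunE.
(* [a f] norms the point [u] of the net, and [t'] is within 1/4 of [u]; applying
   [a f] to [t' - u] costs another 1/4. *)
have uE : of_real k (lp u) =
    \sum_j a f j * t' j - \sum_j a f j * (t' j - u j).
  rewrite -[X in lp X]fE -au -sumrB; apply: eq_bigr => j _.
  by rewrite -mulrBr ffunE/= opprB addrC subrK.
have lpu : lp t' <= lp u + lp (fun j => t' j - u j).
  apply: le_trans (lpnormD p1 _ _); last 2 first.
  - by move=> j; exact: rnorm_ge0.
  - by move=> j; exact: rnorm_ge0.
  apply: ler_lpnorm => // j; first exact: rnorm_ge0.
  by rewrite -[X in rnorm X <= _](subrK (u j)) addrC rnormD.
have main : lp t' <= 2^-1 + mag (\sum_j a f j * t' j).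
  apply: (quarters _ _ _ _ lpu lpB).
  rewrite -[leLHS](@mag_of_real R k) ?lpnorm_ge0// uE.
  exact: le_trans (magB _ _) (lerD (lexx _) (ale _)).
have t'E : \sum_j a f j * t' j = of_real k (lp t)^-1 * \sum_j a f j * t j.
  by rewrite mulr_sumr; apply: eq_bigr => j _; rewrite mulrCA.
have [->|tn0] := eqVneq (lp t) 0; first by rewrite mulr_ge0 ?rnorm_ge0.
have lt0 : 0 < lp t by rewrite lt_def tn0.
have lpt' : lp t' = 1.
  rewrite /lp (_ : (fun j => mag (t' j)) = fun j => (lp t)^-1 * mag (t j)).
    by rewrite lpnormZ ?invr_ge0// ?mulVf// => j; exact: rnorm_ge0.
  by apply/funext => j; rewrite magM mag_of_real// invr_ge0.
move: main; rewrite lpt' t'E magM mag_of_real ?invr_ge0// => main.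
have {main} := half _ main.
rewrite mulrC ler_pdivlMr// -(ler_pM2l (ltr0n R 2)).
by rewrite [leLHS]mulrA mulfV// mul1r.
Qed.

End scalar_lp_norming.

(** * The Hahn-Banach theorem *)

Section real_hahn_banach.
Variables (R : realType) (k : scalar_kind).
Local Notation K := (scalars R k).
Variables (V : lmodType K) (q : V -> R).
Local Notation "r *r x" := (of_real k r *: x) (at level 40).
Hypothesis qD : forall x y, q (x + y) <= q x + q y.
Hypothesis qZ : forall r x, 0 <= r -> q (r *r x) = r * q x.

(** The graph of a real-linear functional which is defined on a real subspace
    and bounded there by [q]. That such a set is single-valued is not required:
    it follows from the bound, since [q 0 = 0]. *)
Definition dominated_graph (G : set (V * R)) : Prop :=
  [/\ G (0, 0),
      forall r x a y b, G (x, a) -> G (y, b) -> G (r *r x + y, r * a + b) &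
      forall x a, G (x, a) -> a <= q x].

Lemma dominated_graphN G x a : dominated_graph G -> G (x, a) -> G (- x, - a).
Proof.
move=> [G0 GL _] Gx; have := GL (-1) _ _ _ _ Gx G0.
rewrite !addr0 mulN1r (_ : of_real k (-1) = -1) ?scaleN1r//.
apply: (@addrI _ 1).
by rewrite -{1}(of_real1 R k) -of_realD !subrr of_real0.
Qed.

Lemma dominated_graph_fun G x a b :
  dominated_graph G -> G (x, a) -> G (x, b) -> a = b.
Proof.
move=> dG Gxa Gxb; have [G0 GL Gq] := dG.
have le_ (c d : R) : G (x, c) -> G (x, d) -> c <= d.
  move=> Gc Gd; have := GL 1 _ _ _ _ Gc (dominated_graphN dG Gd).
  rewrite of_real1 scale1r subrr mul1r => /Gq.
  by have := @qZ 0 0 (lexx _); rewrite mul0r scaler0 => ->; rewrite subr_le0.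
by apply/le_anti; rewrite !le_.
Qed.

(** One more dimension: the value at [v] has to lie between the numbers
    [a - q (x - v)] and the numbers [q (x + v) - a], and subadditivity puts the
    former below the latter. *)
Lemma dominated_graph_extend G v : dominated_graph G ->
  exists c, dominated_graph [set z | exists t y b,
    G (y, b) /\ z = (t *r v + y, t * c + b)].
Proof.
move=> dG; have [G0 GL Gq] := dG.
pose B := [set s | exists x a, G (x, a) /\ s = a - q (x - v)].
have Bub y b : G (y, b) -> ubound B (q (y + v) - b).
  move=> Gy _ [x [a [Gx ->]]]; rewrite lerBlDr addrAC lerBrDr.
  have := GL 1 _ _ _ _ Gx Gy; rewrite of_real1 scale1r mul1r => /Gq.
  have -> : x + y = (x - v) + (y + v) by rewrite [y + v]addrC addrA subrK.
  by move=> /le_trans h; rewrite [leRHS]addrC; apply: h; exact: qD.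
have B0 : B !=set0 by exists (0 - q (0 - v)), 0, 0.
pose c := sup B; exists c.
have cu y b : G (y, b) -> b + c <= q (y + v).
  by move=> Gy; rewrite addrC -lerBrDr; apply: ge_sup => //; exact: Bub.
have cl y b : G (y, b) -> b - c <= q (y - v).
  move=> Gy; rewrite lerBlDr addrC -lerBlDr; apply: ub_le_sup; last by exists y, b.
  by exists (q (0 + v) - 0); exact: Bub.
split=> [|r x a y b [t [x' [a' [Gx [-> ->]]]]] [u [y' [b' [Gy [-> ->]]]]]|].
- by exists 0, 0, 0; rewrite of_real0 scale0r mul0r !addr0.
- exists (r * t + u), (r *r x' + y'), (r * a' + b'); split; first exact: GL.
  rewrite of_realD of_realM scalerDr scalerDl scalerA mulrDr mulrDl mulrA.
  by rewrite [X in (X, _)]addrACA [X in (_, X)]addrACA.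
move=> x a [t [y [b [Gy [-> ->]]]]].
have scale s : 0 < s -> G (s^-1 *r y, s^-1 * b).
  by move=> s0; have := GL s^-1 _ _ _ _ Gy G0; rewrite !addr0.
have [t0|t0|->] := ltgtP t 0; last first.
- by rewrite of_real0 scale0r mul0r !add0r; exact: Gq.
- have -> : t *r v + y = t *r (t^-1 *r y + v).
    rewrite scalerDr scalerA -of_realM mulfV ?gt_eqF// of_real1 scale1r.
    by rewrite addrC.
  have -> : t * c + b = t * (t^-1 * b + c).
    by rewrite mulrDr mulrA mulfV ?gt_eqF// mul1r addrC.
  by rewrite qZ ?(ltW t0)// ler_pM2l//; apply: cu; exact: scale.
have s0 : 0 < - t by rewrite oppr_gt0.
have tN : of_real k t = - of_real k (- t).
  by apply/eqP; rewrite -addr_eq0 -of_realD subrr of_real0.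
have -> : t *r v + y = (- t) *r ((- t)^-1 *r y - v).
  rewrite scalerBr scalerA -of_realM mulfV ?gt_eqF// of_real1 scale1r.
  by rewrite addrC tN scaleNr.
have -> : t * c + b = (- t) * ((- t)^-1 * b - c).
  by rewrite mulrBr mulrA mulfV ?gt_eqF// mul1r addrC mulNr opprK.
by rewrite qZ ?(ltW s0)// ler_pM2l//; apply: cl; exact: scale.
Qed.

Lemma real_hahn_banach G : dominated_graph G -> exists h : V -> R,
  [/\ forall r x y, h (r *r x + y) = r * h x + h y,
      forall x, h x <= q x & forall x a, G (x, a) -> h x = a].
Proof.
move=> dG.
(* Maximality is applied to the sets to be added to [G], so that the empty chain
   needs no special treatment. *)
have [|A [dA Amax]] := @Zorn_bigcup _ [set A | dominated_graph (G `|` A)].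
  move=> F FP Ftot; split; first by left; case: dG.
  - move=> r x a y b GFx GFy.
    suff [A [FA Gx Gy]] : exists A, [/\ A = set0 \/ F A,
        (G `|` A) (x, a) & (G `|` A) (y, b)].
      have dA : dominated_graph (G `|` A).
        by case: FA => [->|/FP//]; rewrite setU0.
      have [_ /(_ r _ _ _ _ Gx Gy) + _] := dA.
      case: FA => [->|FA]; first by rewrite setU0; left.
      by case=> [|AA]; [left|right; exists A].
    case: GFx GFy => [Gx|[A FA Ax]] [Gy|[B FB By]].
    + by exists set0; split; [left|left|left].
    + by exists B; split; [right|left|right].
    + by exists A; split; [right|right|left].
    + case: (Ftot _ _ FA FB) => AB.
      * by exists B; split; [right|right; exact: AB|right].
      * by exists A; split; [right|right|right; exact: AB].
  - move=> x a [|[A FA Ax]]; first by case: dG => _ _; exact.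
    by have [_ _] := FP _ FA; apply; right.
pose M := G `|` A.
have dM : dominated_graph M := dA.
have Mtotal v : exists a, M (v, a).
  have [c dN] := dominated_graph_extend v dM.
  set N := [set z | _] in dN.
  have MN : M `<=` N.
    move=> [x a] Mx; exists 0, x, a; split => //.
    by rewrite of_real0 scale0r mul0r !add0r.
  have Nvc : N (v, c).
    exists 1, 0, 0; case: dM => M0 _ _; split => //.
    by rewrite of_real1 scale1r mul1r !addr0.
  have GN : G `|` N = N by apply/setUidPr => z Gz; apply: MN; left.
  have AN : A `<=` N by move=> z Az; apply: MN; right.
  have [NA|/existsNP[z /not_implyP[Nz Az]]] := pselect (N `<=` A).
    by exists c; right; exact: NA.
  exfalso; apply: (Amax N); last by rewrite /= GN.
  split=> // NA; exact: Az (NA _ Nz).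
have [h hP] := choice Mtotal; exists h; have [_ ML Mq] := dM; split.
- move=> r x y; apply: dominated_graph_fun dM (hP _) _; exact: ML.
- by move=> x; exact: Mq (hP x).
- by move=> x a Gx; apply: dominated_graph_fun dM (hP _) _; left.
Qed.

End real_hahn_banach.

Section hahn_banach.
Variables (R : realType) (k : scalar_kind).
Local Notation K := (scalars R k).
Local Notation mag := (@rnorm R k K^o).

(** The Hahn-Banach theorem for a seminorm, over both scalar fields at once. The
    functional to be extended is given by its graph [G], which may be any
    subspace of [V * K] on which the bound holds. A complex functional is
    recovered from its real part [h] as [h x - i h (i x)]. *)
Lemma hahn_banach (V : lmodType K) (q : V -> R) (G : V -> K -> Prop) :
  (forall x y, q (x + y) <= q x + q y) ->
  (forall c x, q (c *: x) = mag c * q x) ->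
  G 0 0 ->
  (forall c x a y b, G x a -> G y b -> G (c *: x + y) (c * a + b)) ->
  (forall x a, G x a -> mag a <= q x) ->
  exists g : V -> K, [/\ forall c x y, g (c *: x + y) = c * g x + g y,
    forall x, mag (g x) <= q x & forall x a, G x a -> g x = a].
Proof.
move=> qD qZ G0 GL Gq.
have q0 x : 0 <= q x.
  have := qD x (- x); rewrite subrr -scaleN1r qZ.
  have -> : q 0 = 0 by rewrite -(scale0r 0) qZ rnorm0 mul0r.
  by rewrite (@rnormN R k K^o) (_ : mag 1 = 1) ?mul1r; [lra|
    rewrite -(of_real1 R k) mag_of_real].
have qZr (r : R) x : 0 <= r -> q (of_real k r *: x) = r * q x.
  by move=> r0; rewrite qZ mag_of_real.
have le_mag (c : K) : to_real c <= mag c.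
  rewrite -(ler_of_real k) rnormK; case: (k) c => [c|[a b]].
    exact: ler_norm.
  rewrite lecE/= eqxx/=; apply: le_trans (ler_norm a) _.
  by rewrite -sqrtr_sqr ler_wsqrtr// lerDl sqr_ge0.
have to_realD (a b : K) : to_real (a + b) = to_real a + to_real b.
  by case: (k) a b => [//|[? ?] [? ?]].
have to_realZ (r : R) (b : K) : to_real (of_real k r * b) = r * to_real b.
  by case: (k) b => [//|[b1 b2]] /=; rewrite mul0r subr0.
pose GR := [set z : V * R | exists2 a : K, G z.1 a & z.2 = to_real a].
have [|h [hL hq hG]] := @real_hahn_banach R k V q qD qZr GR.
  split.
  - by exists 0 => //=; rewrite -(of_real0 R k) of_realK.
  - move=> r x _ y _ [/= a Gx ->] [/= b Gy ->].
    by exists (of_real k r * a + b); [exact: GL|rewrite to_realD to_realZ].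
  - by move=> x _ [/= a Gx ->]; apply: le_trans (le_mag a) (Gq _ _ Gx).
have {hG} hG x a : G x a -> h x = to_real a by move=> Gx; apply: hG; exists a.
have GZ c x a : G x a -> G (c *: x) (c * a).
  by move=> Gx; have := GL c _ _ _ _ Gx G0; rewrite !addr0.
suff [g [gL gh gG]] : exists g : V -> K,
    [/\ forall c x y, g (c *: x + y) = c * g x + g y,
        forall x, to_real (g x) = h x & forall x a, G x a -> g x = a].
  (* Rotate [g x] to a nonnegative scalar, on which [g] and [h] agree. *)
  exists g; split => // x; have [u u1 ux] := exists_phase (g x).
  have g0 : g 0 = 0 by have := gL (-1) 0 0; rewrite scaler0 addr0 mulN1r addNr.
  have gux : g (u *: x) = u * g x by have := gL u x 0; rewrite g0 !addr0.
  rewrite -(@of_realK R k (mag (g x))) -ux -gux gh.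
  by apply: le_trans (hq _) _; rewrite qZ ler_piMl.
clear qZr le_mag to_realD to_realZ q0 GR qZ Gq.
case: k V q G qD G0 GL h hL hq hG GZ => V q G _ _ _ h hL _ hG GZ.
  by exists h.
have h0 : h 0 = 0.
  by have := hL (-1) 0 0; rewrite scaler0 addr0 mulN1r addNr.
have hD x y : h (x + y) = h x + h y.
  by have := hL 1 x y; rewrite of_real1 scale1r mul1r.
have hZ r x : h (r%:C%C *: x) = r * h x.
  by have := hL r x 0; rewrite h0 !addr0.
have hN x : h (- x) = - h x.
  by apply/eqP; rewrite -addr_eq0 -hD addNr h0.
pose g (x : V) : R[i] := (h x +i* - h ('i%C *: x))%C.
exists g; split=> // [c x y|x a Gx].
  have gD u v : g (u + v) = g u + g v.
    by rewrite /g scalerDr !hD opprD.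
  have gZ r u : g (r%:C%C *: u) = r%:C%C * g u.
    rewrite /g scalerA mulrC -scalerA !hZ.
    by apply/eqP; rewrite eq_complex/= !mul0r subr0 addr0 mulrN !eqxx.
  have gi u : g ('i%C *: u) = 'i%C * g u.
    rewrite /g scalerA -expr2 sqr_i scaleN1r hN opprK.
    by apply/eqP; rewrite eq_complex/= !mul0r !mul1r sub0r opprK add0r !eqxx.
  rewrite gD [c]complexE [X in g X]scalerDl -scalerA !gD gi !gZ.
  by rewrite mulrDl mulrA.
rewrite /g (hG _ _ Gx) (hG _ _ (GZ 'i%C _ _ Gx)).
by case: a {Gx} => a b /=; rewrite !mul0r !mul1r sub0r opprK.
Qed.

End hahn_banach.

(** * Functionals and evaluations *)

Section duality.
Variables (R : realType) (k : scalar_kind).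
Local Notation K := (scalars R k).
Local Notation mag := (@rnorm R k K^o).
Implicit Types V W : normedModType K.

(** The factor 2 avoids approximating the supremum up to an additive error. *)
Lemma ball_norm_half V W (f : V -> W) : ball_bounded f ->
  exists x, rnorm x <= 1 /\ ball_norm f <= 2 * rnorm (f x).
Proof.
move=> fb; have [f0|f0] := eqVneq (ball_norm f) 0.
  by exists 0; rewrite rnorm0 f0 mulr_ge0 ?rnorm_ge0.
have {}f0 : 0 < ball_norm f by rewrite lt_def f0 ball_norm_ge0.
have e0 : 0 < ball_norm f / 2 by rewrite divr_gt0.
have [|_ [x x1 <-] h] := @sup_adherent R
    [set rnorm (f x) | x in [set x | rnorm x <= 1]] _ e0.
  split; first by exists (rnorm (f 0)), 0 => //=; rewrite rnorm0.
  by case: fb => M fM; exists M => _ [x /fM xM <-].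
exists x; split => //; move: h; rewrite -/(ball_norm f) => h.
rewrite mulrC -ler_pdivrMr//; apply/ltW; apply: le_lt_trans h.
by rewrite [X in _ <= X - _](splitr (ball_norm f)) addrK.
Qed.

Lemma exists_bounded_functional V (g : V -> K) (C : R) : 0 <= C ->
  (forall c x y, g (c *: x + y) = c * g x + g y) ->
  (forall x, mag (g x) <= C * rnorm x) ->
  exists phi : dual V, rnorm phi <= C /\ forall x, phi x = g x.
Proof.
move=> C0 gL gC.
pose gl : {linear V -> K^o} := HB.pack (g : V -> K^o)
  (GRing.isLinear.Build K V K^o _ (g : V -> K^o) gL).
have gP : (g : V -> K^o) \in @bounded_op_pred R k V K^o.
  by apply/asboolP; split => //; exact: (@linear_ball_continuous _ _ _ _ gl C).
exists (BoundedOp gP); split => //; rewrite [leLHS]rnorm_op.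
apply: Defs.ball_norm_le => x x1; apply: le_trans (gC x) _.
by rewrite ler_piMr//.
Qed.

Lemma exists_norming_functional V (y : V) :
  exists phi : dual V, rnorm phi <= 1 /\ phi y = of_real k (rnorm y).
Proof.
pose G (x : V) (a : K) := exists c, x = c *: y /\ a = c * of_real k (rnorm y).
have [||||x a|g [gL gq gG]] := @hahn_banach R k V (@rnorm R k V) G.
- exact: rnormD.
- exact: rnormZ.
- by exists 0; rewrite scale0r mul0r.
- move=> c x a y' b [d [-> ->]] [e [-> ->]]; exists (c * d + e).
  by rewrite scalerDl scalerA mulrDl mulrA.
- by move=> [c [-> ->]]; rewrite magM mag_of_real ?rnorm_ge0// -rnormZ.
have [|phi [phi1 phiE]] := @exists_bounded_functional V g 1 ler01 gL.
  by move=> x; rewrite mul1r.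
exists phi; split => //; rewrite phiE; apply: gG; exists 1.
by rewrite scale1r mul1r.
Qed.

(** Evaluation at a point, as an element of the bidual. *)
Lemma exists_bidual_eval V (x : V) :
  exists phi : dual (dual V), rnorm phi <= rnorm x /\ forall f, phi f = f x.
Proof.
apply: (@exists_bounded_functional (dual V) (fun f : dual V => f x)) => //.
  exact: rnorm_ge0.
by move=> f; rewrite mulrC; exact: rnorm_op_le.
Qed.

Section evaluation.
Variables (m : nat) (X : normedModType K).
Local Notation Q := (scalar_hpoly m X).

Lemma rnorm_hpoly_le (q : Q) x : mag (q x) <= rnorm q * rnorm x ^+ m.
Proof.
rewrite [rnorm q]rnorm_hpoly; apply: ball_norm_homogeneous.
  exact: hpoly_homogeneous.
exact: hpoly_bounded.
Qed.

Lemma exists_hpoly_eval (x : X) : exists phi : dual Q,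
  rnorm phi <= rnorm x ^+ m /\ forall q, phi q = q x.
Proof.
apply: (@exists_bounded_functional Q (fun q : Q => q x)) => //.
  exact/exprn_ge0/rnorm_ge0.
by move=> q; rewrite mulrC; exact: rnorm_hpoly_le.
Qed.

(** The evaluation functional at [x] on the space of [m]-homogeneous
    polynomials. *)
Definition hpoly_eval (x : X) : dual Q := projT1 (cid (exists_hpoly_eval x)).

Lemma hpoly_evalE x q : hpoly_eval x q = q x.
Proof. exact: (projT2 (cid (exists_hpoly_eval x))).2. Qed.

Lemma rnorm_hpoly_eval x : rnorm (hpoly_eval x) <= rnorm x ^+ m.
Proof. exact: (projT2 (cid (exists_hpoly_eval x))).1. Qed.

End evaluation.

End duality.

(** * Multilinear maps and polarization *)

Section multilinear.
Variables (R : realType) (k : scalar_kind) (X Y : normedModType (scalars R k)).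
Local Notation K := (scalars R k).

Lemma dfwith_id (I : eqType) (v : I -> X) i : dfwith v i (v i) = v.
Proof.
apply/funext => j; have [<-|ij] := eqVneq i j; first by rewrite dfwithin.
by rewrite dfwithout.
Qed.

Lemma multilinear_sumZ m (A : ('I_m -> X) -> Y) (I : Type) (r : seq I)
    (c : I -> K) (x : I -> X) (w : 'I_m -> X) j : multilinear_map A ->
  A (dfwith w j (\sum_(i <- r) c i *: x i)) =
  \sum_(i <- r) c i *: A (dfwith w j (x i)).
Proof.
move=> lA; have A0 : A (dfwith w j 0) = 0.
  by have := lA j w (-1) 0 0; rewrite scaler0 addr0 scaleN1r addNr.
by elim/big_rec2: _ => [//|i _ b _ <-]; exact: lA.
Qed.

Lemma multilinearB m (A : ('I_m -> X) -> Y) (w : 'I_m -> X) j x y :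
  multilinear_map A ->
  A (dfwith w j x) - A (dfwith w j y) = A (dfwith w j (x - y)).
Proof.
by move=> lA; have := lA j w (-1) y x; rewrite !scaleN1r [x - y]addrC => ->;
  rewrite addrC.
Qed.

(** The family with first term [x], followed by [u]. *)
Definition ord_cons (T : Type) n (x : T) (u : 'I_n -> T) (j : 'I_n.+1) : T :=
  oapp u x (unlift ord0 j).

Lemma ord_cons_dfwith n x (u : 'I_n -> X) i z :
  ord_cons x (dfwith u i z) = dfwith (ord_cons x u) (lift ord0 i) z.
Proof.
apply/funext => j; rewrite /ord_cons; case: (unliftP ord0 j) => [j'|] ->/=.
  have [<-|ij] := eqVneq i j'; first by rewrite !dfwithin.
  rewrite !dfwithout ?liftK//.
by rewrite dfwithout ?unlift_none// eq_sym neq_lift.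
Qed.

Lemma dfwith_ord0 n (w : 'I_n.+1 -> X) x :
  dfwith w ord0 x = ord_cons x (fun j => w (lift ord0 j)).
Proof.
apply/funext => j; rewrite /ord_cons; case: (unliftP ord0 j) => [j'|] ->/=.
  by rewrite dfwithout.
by rewrite dfwithin.
Qed.

Lemma big_ffun_ord_recl (I : finType) n (F : {ffun 'I_n.+1 -> I} -> Y) :
  \sum_f F f = \sum_i \sum_(g : {ffun 'I_n -> I}) F [ffun j => ord_cons i g j].
Proof.
rewrite pair_big/=.
rewrite (reindex (fun p : I * {ffun 'I_n -> I} => [ffun j => ord_cons p.1 p.2 j]))//=.
exists (fun f => (f ord0, [ffun j => f (lift ord0 j)])) => [[i g] _|f _] /=.
  congr pair; first by rewrite ffunE /ord_cons unlift_none.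
  by apply/ffunP => j; rewrite !ffunE /ord_cons liftK.
apply/ffunP => j; rewrite ffunE /ord_cons.
by case: (unliftP ord0 j) => [j'|] -> //=; rewrite ffunE.
Qed.

(** By induction on [m], fixing the first argument of [A]. *)
Lemma multilinear_expand m (A : ('I_m -> X) -> Y) (I : finType) (c : I -> K)
    (v : I -> X) : multilinear_map A ->
  A (fun=> \sum_i c i *: v i) =
  \sum_(f : {ffun 'I_m -> I}) (\prod_j c (f j)) *: A (fun j => v (f j)).
Proof.
elim: m A => [|m IH] A lA.
  have ord0_void (T : Type) (g h : 'I_0 -> T) : g = h by apply/funext => -[].
  rewrite (big_pred1 (ffun0 (card_ord 0))) => [|f].
    by rewrite big_ord0 scale1r; congr A; exact: ord0_void.
  by apply/esym/eqP/ffunP => -[].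
rewrite -[X in A X](dfwith_id _ ord0) multilinear_sumZ// big_ffun_ord_recl.
apply: eq_bigr => i _; rewrite dfwith_ord0.
rewrite (IH (fun u => A (ord_cons (v i) u))); last first.
  by move=> j w a x y; rewrite !ord_cons_dfwith; exact: lA.
rewrite scaler_sumr; apply: eq_bigr => g _.
rewrite scalerA big_ord_recl ffunE /ord_cons unlift_none/=; congr (_ * _ *: A _).
  by apply: eq_bigr => j _; rewrite ffunE liftK.
by apply/funext => j; rewrite ffunE; case: unlift.
Qed.

(** The polarization formula is the sum of [q] over the vertices
    [\sum_(i | s i) v i] of a parallelepiped, with these signs. *)
Definition polar_sign m (s : {ffun 'I_m -> bool}) : K :=
  \prod_i (if s i then 1 else -1).

Definition vertex m (s : {ffun 'I_m -> bool}) (v : 'I_m -> X) : X :=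
  \sum_i (s i)%:R *: v i.

(** The coefficient of the term of index [f] when a multilinear map is expanded at
    all vertices. If [f] omits an index, flipping the choice made there cancels
    the signs in pairs; if [f] is a permutation, only the full sum counts. *)
Lemma polar_sign_sum m (f : {ffun 'I_m -> 'I_m}) :
  \sum_s polar_sign s * \prod_j (s (f j))%:R = (injectiveb f)%:R :> K.
Proof.
have [/injectiveP f_inj|f_ninj] := boolP (injectiveb f).
  have [g fg gf] := injF_bij f_inj.
  rewrite (bigD1 [ffun=> true])//= [X in _ + X]big1 => [|s sn1].
    by rewrite addr0 /polar_sign !big1 ?mulr1// => j _; rewrite ffunE.
  have [i /negbTE si] : exists i, ~~ s i.
    apply/existsP; rewrite -negb_forall; apply: contra sn1 => /forallP s1.
    by apply/eqP/ffunP => i; rewrite ffunE s1.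
  by rewrite (bigD1 (g i))//= gf si mul0r mulr0.
have [i0 i0f] : exists i, i \notin codom f.
  apply/existsP; rewrite -negb_forall; apply: contra f_ninj => /forallP f_surj.
  have /image_injP f_inj : #|[seq f i | i in 'I_m]| == #|'I_m|.
    by apply/eqP/eq_card => i; exact: f_surj.
  by apply/injectiveP => i j; exact: f_inj.
(* Flipping the sign at [i0] changes the sign of the term. *)
pose t (s : {ffun 'I_m -> bool}) := [ffun i => if i == i0 then ~~ s i else s i].
have tK : involutive t.
  by move=> s; apply/ffunP => i; rewrite !ffunE; case: eqP => // _; rewrite negbK.
set S := \sum_s _; have : S = - S.
  rewrite {1}/S (reindex_inj (inv_inj tK)) -sumrN; apply: eq_bigr => s _.
  rewrite /polar_sign (bigD1 i0)//= [in RHS](bigD1 i0)//= -!mulNr.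
  congr (_ * _ * _).
  - by rewrite ffunE eqxx; case: (s i0); rewrite ?opprK.
  - by apply: eq_bigr => i /negbTE ii0; rewrite ffunE ii0.
  - apply: eq_bigr => j _; rewrite ffunE.
    by case: eqP => // fj; move: i0f; rewrite -fj codom_f.
move/eqP; rewrite -addr_eq0 -mulr2n mulrn_eq0/= => /eqP ->//.
Qed.

Lemma polarization m (A : ('I_m -> X) -> Y) v : multilinear_map A ->
  \sum_s polar_sign s *: A (fun=> vertex s v) =
  \sum_(f : {ffun 'I_m -> 'I_m} | injectiveb f) A (fun j => v (f j)).
Proof.
move=> lA; rewrite [RHS]big_mkcond/=.
under eq_bigr do rewrite /vertex multilinear_expand// scaler_sumr.
rewrite exchange_big/=; apply: eq_bigr => f _.
under eq_bigr do rewrite scalerA.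
rewrite -scaler_suml polar_sign_sum.
by case: injectiveb; rewrite ?scale1r ?scale0r.
Qed.

Lemma multilinear_map_perm m (A : ('I_m -> X) -> Y) (f : {ffun 'I_m -> 'I_m}) :
  multilinear_map A -> injectiveb f -> multilinear_map (fun v => A (fun j => v (f j))).
Proof.
move=> lA /injectiveP f_inj i v a x y; have [g fg gf] := injF_bij f_inj.
have E z : (fun j => dfwith v i z (f j)) = dfwith (fun j => v (f j)) (g i) z.
  apply/funext => j; have [ij|ij] := eqVneq (f j) i.
    by rewrite -{1}ij -ij fg !dfwithin.
  have gij : g i != j by apply: contra ij => /eqP <-; rewrite gf.
  by rewrite !dfwithout// eq_sym.
by rewrite !E; exact: lA.
Qed.

Lemma multilinear_map_sym m (A : ('I_m -> X) -> Y) : multilinear_map A ->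
  multilinear_map (fun v =>
    \sum_(f : {ffun 'I_m -> 'I_m} | injectiveb f) A (fun j => v (f j))).
Proof.
move=> lA i v a x y; rewrite scaler_sumr -big_split/=; apply: eq_bigr => f f_inj.
exact: (multilinear_map_perm lA f_inj).
Qed.

(** Local Lipschitz continuity, by replacing the arguments one at a time. *)
Lemma multilinear_diag_continuous m (A : ('I_m -> X) -> Y) :
  multilinear_map A ->
  (forall r : R, exists M, forall v, (forall i, rnorm (v i) <= r) -> rnorm (A v) <= M) ->
  continuous (fun x => A (fun=> x)).
Proof.
move=> lA bA x; have [M AM] := bA (rnorm x + 1).
have M0 : 0 <= M.
  apply: le_trans (AM (fun=> 0) _); first exact: rnorm_ge0.
  by move=> i; rewrite rnorm0 addr_ge0// rnorm_ge0.
have r1 : 1 <= rnorm x + 1 by rewrite lerDr rnorm_ge0.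
(* The argument with difference [y - x] is normalised, and [AM] is then applied
   to arguments of norm at most [rnorm x + 1]. *)
have lip y : rnorm (y - x) <= 1 ->
    rnorm (A (fun=> y) - A (fun=> x)) <= (m%:R * M) * rnorm (y - x).
  move=> yx1; pose w n (j : 'I_m) := if (j < n)%N then y else x.
  have yr : rnorm y <= rnorm x + 1.
    rewrite -[y](subrK x) addrC; apply: le_trans (rnormD _ _) _.
    by rewrite lerD2l.
  have wr n j : rnorm (w n j) <= rnorm x + 1.
    by rewrite /w; case: ifP => // _; rewrite lerDl.
  have step (i : 'I_m) :
      rnorm (A (w i.+1) - A (w i)) <= M * rnorm (y - x).
    have -> : w i.+1 = dfwith (w i) i y.
      apply/funext => j; have [<-|ij] := eqVneq i j; first by rewrite dfwithin /w ltnSn.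
      rewrite dfwithout// /w ltnS leq_eqVlt (_ : (j == i :> nat) = false)//.
      by apply/negbTE; rewrite eq_sym.
    have {2}-> : w i = dfwith (w i) i x.
      by rewrite -[LHS](dfwith_id _ i); congr dfwith; rewrite /w ltnn.
    rewrite multilinearB//; have [->|yx] := eqVneq (y - x) 0.
      have -> : A (dfwith (w i) i 0) = 0.
        by rewrite -(subrr y) -multilinearB// subrr.
      by rewrite !rnorm0 mulr0.
    have n0 : of_real k (rnorm (y - x)) != 0.
      by rewrite rnormK normr_eq0.
    pose c := of_real k (rnorm (y - x)); pose z := c^-1 *: (y - x).
    have zE : y - x = c *: z by rewrite /z scalerA mulfV// scale1r.
    have z1 : rnorm z = 1.
      have cE : c = `|y - x| by exact: rnormK.
      apply: (@of_real_inj R k); rewrite rnormK normrZ normfV cE normr_id.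
      by rewrite mulVf ?normr_eq0// of_real1.
    have := lA i (w i) c z 0; rewrite addr0 -zE => ->.
    have -> : A (dfwith (w i) i 0) = 0.
      by rewrite -(subrr y) -multilinearB// subrr.
    rewrite addr0 rnormZ mag_of_real ?rnorm_ge0// mulrC ler_wpM2r ?rnorm_ge0//.
    apply: AM => j; have [<-|ij] := eqVneq i j; first by rewrite dfwithin z1.
    by rewrite dfwithout.
  have -> : A (fun=> y) - A (fun=> x) = \sum_(i < m) (A (w i.+1) - A (w i)).
    rewrite -(big_mkord xpredT (fun n => A (w n.+1) - A (w n))) telescope_sumr//.
    congr (A _ - A _); apply/funext => j; rewrite /w//.
    by rewrite ltn_ord.
  apply: le_trans (rnorm_sum _ _ _) _.
  apply: le_trans (ler_sum _ (fun i _ => step i)) _.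
  by rewrite sumr_const card_ord -[leLHS]mulr_natl mulrA.
pose N := m%:R * M + 1; have N0 : 0 < N by rewrite ltr_wpDl// mulr_ge0.
have kN0 : 0 < of_real k N :> K.
  by rewrite lt_def -{2}(of_real0 R k) ler_of_real (ltW N0) andbT
    -(of_real0 R k) (inj_eq (@of_real_inj R k)) gt_eqF.
apply/cvgrPdist_le => /= e e0; near=> y.
have xy1 : `|x - y| <= 1.
  by apply/ltW; near: y; apply: (@cvgr_dist_lt _ _ _ (nbhs x) _ id).
have xye : `|x - y| <= e / of_real k N.
  apply/ltW; near: y; apply: (@cvgr_dist_lt _ _ _ (nbhs x) _ id) => //.
  by rewrite divr_gt0.
have {xy1} /lip : rnorm (y - x) <= 1 by rewrite rnorm_le of_real1 distrC.
rewrite rnorm_le distrC => /le_trans; apply; rewrite of_realM rnormK distrC.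
apply: (@le_trans _ _ (of_real k N * `|x - y|)).
  by rewrite ler_wpM2r// ler_of_real lerDl.
by rewrite mulrC -ler_pdivlMr.
Unshelve. all: by end_near. Qed.

End multilinear.

(** * Functionals on the dual of the space of polynomials *)

Section bidual_polynomial.
Variables (R : realType) (k : scalar_kind).
Local Notation K := (scalars R k).
Local Notation mag := (@rnorm R k K^o).
Variables (m : nat) (X : normedModType K).
Local Notation Q := (scalar_hpoly m X).

Lemma op_sumE (V W : normedModType K) (I : Type) (r : seq I) (P : pred I)
    (u : I -> bounded_op V W) x :
  (\sum_(i <- r | P i) u i) x = \sum_(i <- r | P i) u i x.
Proof. exact: (big_morph (fun w : bounded_op V W => w x)). Qed.

(** The polarization of the polynomial [hpoly_eval m : X -> dual Q], up to the
    factor [m`!]. *)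
Definition polar_eval (v : 'I_m -> X) : dual Q :=
  \sum_s polar_sign R k s *: hpoly_eval m (vertex s v).

(** This is [m`!]; only its positivity matters. *)
Definition num_perm : nat := #|[pred f : {ffun 'I_m -> 'I_m} | injectiveb f]|.

Lemma num_perm_gt0 : (0 < num_perm)%N.
Proof.
apply/card_gt0P; exists [ffun i => i]; rewrite inE; apply/injectiveP => i j.
by rewrite !ffunE.
Qed.

(** Each evaluation of [polar_eval v] at a polynomial is the symmetrisation of a
    multilinear map which defines it. *)
Lemma polar_evalE (q : Q) : exists B : ('I_m -> X) -> K^o,
  [/\ multilinear_map B, forall v, polar_eval v q = B v &
      forall x, B (fun=> x) = num_perm%:R *: q x].
Proof.
have /asboolP[[A lA qA] _] := hpolyP q.
exists (fun v => \sum_(f : {ffun 'I_m -> 'I_m} | injectiveb f) A (fun j => v (f j))).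
split=> [|v|x]; first exact: multilinear_map_sym.
  apply: etrans (polarization v lA); rewrite op_sumE.
  by apply: eq_bigr => s _; rewrite -qA -hpoly_evalE.
by rewrite sumr_const scaler_nat qA.
Qed.

Lemma multilinear_polar_eval : multilinear_map polar_eval.
Proof.
move=> i v a x y; apply/val_inj/funext => q; have [B [lB E _]] := polar_evalE q.
apply: etrans (E _) _; apply: etrans (lB i v a x y) _.
by rewrite -!E.
Qed.

Lemma polar_eval_diag x : polar_eval (fun=> x) = num_perm%:R *: hpoly_eval m x.
Proof.
apply/val_inj/funext => q; have [B [_ E diag]] := polar_evalE q.
apply: etrans (E _) _; apply: etrans (diag x) _.
by rewrite -hpoly_evalE.
Qed.

Lemma rnorm_vertex (s : {ffun 'I_m -> bool}) (v : 'I_m -> X) (r : R) :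
  (forall i, rnorm (v i) <= r) -> rnorm (vertex s v) <= \sum_(i < m) r.
Proof.
move=> vr; apply: le_trans (rnorm_sum _ _ _) _; apply: ler_sum => i _.
rewrite rnormZ; case: (s i); rewrite ?rnorm0 ?mul0r; last first.
  exact: le_trans (rnorm_ge0 _) (vr i).
by rewrite -[1%:R](of_real1 R k) mag_of_real// mul1r.
Qed.

(** A functional on the dual of the space of polynomials restricts, along the
    evaluations, to a polynomial. *)
Lemma bidual_hpoly (gamma : dual (dual Q)) :
  exists G : Q, forall x, G x = gamma (hpoly_eval m x).
Proof.
have N0 : num_perm%:R != 0 :> K by rewrite pnatr_eq0 -lt0n num_perm_gt0.
have gL (a : K) u w : gamma (a *: u + w) = a * gamma u + gamma w.
  exact: (bounded_op_linear gamma).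
have gZ (a : K) u : gamma (a *: u) = a * gamma u.
  have g0 : gamma 0 = 0 by have := gL (-1) 0 0; rewrite scaler0 addr0 mulN1r addNr.
  by have := gL a u 0; rewrite g0 !addr0.
pose T (v : 'I_m -> X) : K^o := num_perm%:R^-1 * gamma (polar_eval v).
have TE x : T (fun=> x) = gamma (hpoly_eval m x).
  by rewrite /T polar_eval_diag gZ mulrA mulVf// mul1r.
have lT : multilinear_map T.
  move=> i v a x y; rewrite /T multilinear_polar_eval gL.
  by rewrite mulrDr; congr (_ + _); exact: mulrCA.
have Tb (r : R) : exists M, forall v, (forall i, rnorm (v i) <= r) ->
    rnorm (T v) <= M.
  exists (mag num_perm%:R^-1 * (rnorm gamma *
    \sum_(s : {ffun 'I_m -> bool}) mag (polar_sign R k s) * (\sum_(i < m) r) ^+ m)) => v vr.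
  rewrite [leLHS]magM ler_wpM2l ?rnorm_ge0//.
  apply: le_trans (rnorm_op_le _ _) _; rewrite ler_wpM2l ?rnorm_ge0//.
  apply: le_trans (rnorm_sum _ _ _) _; apply: ler_sum => s _.
  rewrite rnormZ ler_wpM2l ?rnorm_ge0//; apply: le_trans (rnorm_hpoly_eval _ _) _.
  have vs := rnorm_vertex s vr.
  by apply: lerXn2r; rewrite ?nnegrE ?rnorm_ge0//; exact: le_trans (rnorm_ge0 _) vs.
have GP : (fun x => T (fun=> x)) \in @hpoly_pred R k m X K^o.
  apply/asboolP; split; first by exists T.
  exact: multilinear_diag_continuous lT Tb.
by exists (HPoly GP) => x; rewrite -TE.
Qed.

End bidual_polynomial.

(** * Weak ell_p norms *)

Section weak_lp.
Variables (R : realType) (k : scalar_kind) (p : R) (I : finType).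
Hypothesis p1 : 1 <= p.
Local Notation K := (scalars R k).
Local Notation mag := (@rnorm R k K^o).
Variable Z : normedModType K.
Implicit Types z : I -> dual Z.

(** The weak* ell_p norm of a finite family of functionals. *)
Definition weak_lpnorm z : R :=
  sup [set lpnorm p (fun j => mag (z j q)) | q in [set q : Z | rnorm q <= 1]].

Lemma weak_lpnorm_ub z q :
  rnorm q <= 1 -> lpnorm p (fun j => mag (z j q)) <= weak_lpnorm z.
Proof.
move=> q1; apply: ub_le_sup; last by exists q.
exists (lpnorm p (fun j => rnorm (z j))) => _ [x x1 <-].
apply: ler_lpnorm => // j; first exact: rnorm_ge0.
apply: le_trans (rnorm_op_le _ _) _.
by apply: ler_piMr => //; exact: rnorm_ge0.
Qed.

Lemma weak_lpnorm_le z (c : R) :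
  (forall q, rnorm q <= 1 -> lpnorm p (fun j => mag (z j q)) <= c) ->
  weak_lpnorm z <= c.
Proof.
move=> zc; apply: ge_sup; last by move=> _ [q /zc h <-].
by exists (lpnorm p (fun j => mag (z j 0))), 0 => //=; rewrite rnorm0.
Qed.

Lemma weak_lpnorm_ge0 z : 0 <= weak_lpnorm z.
Proof.
apply: le_trans (weak_lpnorm_ub z (_ : rnorm 0 <= 1)); first exact: powR_ge0.
by rewrite rnorm0.
Qed.

(** A combination of the family with coefficients [a] has norm at most the weak
    norm, if [a] has norm at most 1 in the dual of ell_p. *)
Lemma rnorm_lincomb_le z (a : I -> K) :
  (forall t, mag (\sum_j a j * t j) <= lpnorm p (fun j => mag (t j))) ->
  rnorm (\sum_j a j *: z j) <= weak_lpnorm z.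
Proof.
move=> ale; rewrite [leLHS]rnorm_op; apply: Defs.ball_norm_le => q q1.
rewrite op_sumE; apply: le_trans (weak_lpnorm_ub z q1).
exact: (ale (fun j => z j q)).
Qed.

(** The weak norm does not change when the unit ball of [Z] is enlarged to that
    of the bidual: a value [phi (z j)] is tested against norming coefficients,
    and [phi (\sum_j a j *: z j)] is bounded by the norm of the combination. *)
Lemma weak_lpnorm_bidual z :
  sup [set lpnorm p (fun j => mag (phi (z j))) |
    phi in [set phi : dual (dual Z) | rnorm phi <= 1]] = weak_lpnorm z.
Proof.
have le_phi (phi : dual (dual Z)) : rnorm phi <= 1 ->
    lpnorm p (fun j => mag (phi (z j))) <= weak_lpnorm z.
  move=> phi1; have [a ale aE] := lpnorm_norming p1 (fun j => phi (z j) : K).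
  rewrite -(@mag_of_real R k (lpnorm _ _)) ?powR_ge0// -aE.
  have -> : \sum_j a j * phi (z j) = phi (\sum_j a j *: z j).
    by rewrite linear_sum/=; apply: eq_bigr => j _; rewrite linearZ.
  apply: le_trans (rnorm_op_le _ _) _.
  apply: le_trans (rnorm_lincomb_le z ale).
  by rewrite ler_piMl ?rnorm_ge0.
apply/le_anti/andP; split.
  apply: ge_sup; last by move=> _ [phi /le_phi h <-].
  by exists (lpnorm p (fun j => mag ((0 : dual (dual Z)) (z j)))), 0 => //=;
    rewrite rnorm0.
apply: weak_lpnorm_le => q q1; have [phi [phi_q phiE]] := exists_bidual_eval q.
apply: ub_le_sup; first by exists (weak_lpnorm z) => _ [f /le_phi h <-].
exists phi; first exact: le_trans phi_q q1.
by congr lpnorm; apply/funext => j; rewrite phiE.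
Qed.

End weak_lp.

(** * From evaluations to arbitrary functionals *)

Section evaluation_combinations.
Variables (R : realType) (k : scalar_kind) (p : R).
Hypothesis p1 : 1 <= p.
Local Notation K := (scalars R k).
Local Notation mag := (@rnorm R k K^o).
Variables (m : nat) (X : normedModType K).
Local Notation Q := (scalar_hpoly m X).

Lemma hpoly_sumE (J : Type) (r : seq J) (P : pred J) (G : J -> Q) x :
  (\sum_(i <- r | P i) G i : Q) x = \sum_(i <- r | P i) G i x.
Proof. exact: (big_morph (fun q : Q => q x)). Qed.

(** Linear combinations of evaluations. *)
Definition eval_comb n (x : 'I_n -> X) (lam : 'I_n -> K) : dual Q :=
  \sum_l lam l *: hpoly_eval m (x l).

Lemma eval_combE n (x : 'I_n -> X) (lam : 'I_n -> K) (q : Q) :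
  eval_comb x lam q = \sum_l lam l * q (x l).
Proof.
by rewrite /eval_comb op_sumE; apply: eq_bigr => l _; rewrite -hpoly_evalE.
Qed.

Lemma eval_combZ n (x : 'I_n -> X) (lam : 'I_n -> K) c :
  eval_comb x (fun l => c * lam l) = c *: eval_comb x lam.
Proof.
by rewrite /eval_comb scaler_sumr; apply: eq_bigr => l _; rewrite scalerA.
Qed.

(** The concatenation of two finite families. *)
Definition ord_cat (T : Type) n1 n2 (f1 : 'I_n1 -> T) (f2 : 'I_n2 -> T)
    (i : 'I_(n1 + n2)) : T :=
  match fintype.split i with inl i1 => f1 i1 | inr i2 => f2 i2 end.

Lemma eval_comb_cat n1 n2 (x1 : 'I_n1 -> X) (x2 : 'I_n2 -> X)
    (lam1 : 'I_n1 -> K) (lam2 : 'I_n2 -> K) :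
  eval_comb (ord_cat x1 x2) (ord_cat lam1 lam2) =
  eval_comb x1 lam1 + eval_comb x2 lam2.
Proof.
rewrite /eval_comb big_split_ord/= /ord_cat; congr (_ + _).
  by apply: eq_bigr => i _; rewrite (unsplitK (inl i)).
by apply: eq_bigr => i _; rewrite (unsplitK (inr i)).
Qed.

Section max_seminorm.
Variable J : finType.
Implicit Types f g : J -> dual Q.

(** The norm of the [J]-fold sup-sum of [dual Q]. *)
Definition max_norm f : R := \big[Num.max/0]_i rnorm (f i).

Lemma max_norm_ub f i : rnorm (f i) <= max_norm f.
Proof. exact: le_bigmax. Qed.

Lemma max_norm_le f (c : R) :
  0 <= c -> (forall i, rnorm (f i) <= c) -> max_norm f <= c.
Proof. by move=> c0 fc; apply/bigmax_leP; split => // i _; exact: fc. Qed.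

Lemma max_norm_ge0 f : 0 <= max_norm f.
Proof. exact: bigmax_ge_id. Qed.

Lemma max_normD f g : max_norm (f + g) <= max_norm f + max_norm g.
Proof.
apply: max_norm_le => [|i]; first by rewrite addr_ge0 ?max_norm_ge0.
by apply: le_trans (rnormD _ _) _; rewrite lerD ?max_norm_ub.
Qed.

Lemma max_normZ c f : max_norm (c *: f) = mag c * max_norm f.
Proof.
rewrite /max_norm (big_morph (fun r => mag c * r)
  (fun x y => maxr_pMr x y (rnorm_ge0 _)) (mulr0 _)).
by apply: eq_bigr => i _; rewrite -rnormZ.
Qed.

End max_seminorm.

(** The functional [z |-> \sum_j z j (q j)] is bounded by the weak norm on all
    families as soon as it is on families of combinations of evaluations. One
    factor 2 in the constant comes from the finite norming family, the other from
    norming the polynomials [G_ i] up to a factor 2. *)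
Lemma eval_comb_bound_bidual n (D : R) (q : 'I_n -> Q) : 0 <= D ->
  (forall l, (0 < l)%N -> forall (x : 'I_n -> 'I_l -> X) (lam : 'I_n -> 'I_l -> K),
    mag (\sum_j eval_comb (x j) (lam j) (q j)) <=
    D * weak_lpnorm p (fun j => eval_comb (x j) (lam j))) ->
  forall z : 'I_n -> dual Q,
    mag (\sum_j z j (q j)) <= 4 * D * weak_lpnorm p z.
Proof.
move=> D0 qD z.
have [J [a [ale ageq]]] := @lpnorm_finite_norming R k p 'I_n p1.
pose T (e : 'I_n -> dual Q) : J -> dual Q := fun i => \sum_j a i j *: e j.
(* The functional to be extended, on the image under [T] of the families of
   combinations of evaluations. *)
pose G (f : J -> dual Q) (c : K) := exists l, (0 < l)%N /\
  exists (x : 'I_n -> 'I_l -> X) (lam : 'I_n -> 'I_l -> K),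
  f = T (fun j => eval_comb (x j) (lam j)) /\
  c = \sum_j eval_comb (x j) (lam j) (q j).
have TL c e e' : T (fun j => c *: e j + e' j) = c *: T e + T e'.
  apply/funext => i; rewrite [RHS]/(c *: T e i + T e' i) /T.
  transitivity (\sum_j (c *: (a i j *: e j) + a i j *: e' j)).
    by apply: eq_bigr => j _; rewrite scalerDr !scalerA mulrC.
  by rewrite big_split/= -scaler_sumr.
have weakT e : weak_lpnorm p e <= 2 * max_norm (T e).
  apply: weak_lpnorm_le => g g1; have [i /le_trans] := ageq (fun j => e j g).
  apply; rewrite ler_pM2l//; apply: le_trans (max_norm_ub (T e) i).
  have -> : \sum_j a i j * e j g = T e i g by rewrite /T op_sumE.
  by apply: le_trans (rnorm_op_le _ _) _; rewrite ler_piMr ?rnorm_ge0.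
have [|||||g [gL gb gG]] :=
    @hahn_banach R k (J -> dual Q) (fun f => 2 * D * max_norm f) G.
- by move=> f f'; rewrite -mulrDr ler_wpM2l ?mulr_ge0// max_normD.
- by move=> c f; rewrite max_normZ mulrCA.
- exists 1%N; split => //; exists (fun _ _ => 0), (fun _ _ => 0).
  have E0 : eval_comb (fun=> 0) (fun=> 0) = 0 :> dual Q.
    by move=> l; rewrite /eval_comb big1// => i _; rewrite scale0r.
  split; last by rewrite big1// => j _; rewrite E0.
  by apply/funext => i; rewrite /T big1// => j _; rewrite E0 scaler0.
- move=> c _ _ _ _ [l [l0 [x [lam [-> ->]]]]] [l' [_ [x' [lam' [-> ->]]]]].
  exists (l + l')%N; split; first by rewrite addn_gt0 l0.
  exists (fun j => ord_cat (x j) (x' j)).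
  exists (fun j => ord_cat (fun i => c * lam j i) (lam' j)).
  have E j : eval_comb (ord_cat (x j) (x' j)) (ord_cat (fun i => c * lam j i) (lam' j))
      = c *: eval_comb (x j) (lam j) + eval_comb (x' j) (lam' j).
    by rewrite eval_comb_cat eval_combZ.
  split; first by rewrite -TL; congr T; apply/funext => j.
  rewrite mulr_sumr -big_split/=; apply: eq_bigr => j _.
  by rewrite E.
- move=> _ _ [l [l0 [x [lam [-> ->]]]]]; apply: le_trans (qD l l0 x lam) _.
  by rewrite [2 * D]mulrC -mulrA ler_wpM2l.
pose single (i : J) (zeta : dual Q) : J -> dual Q :=
  fun i' => if i' == i then zeta else 0.
have singleP i c zeta xi i' :
    single i (c *: zeta + xi) i' = c *: single i zeta i' + single i xi i'.
  by rewrite /single; case: eqP => // _; rewrite scaler0 addr0.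
have singleZ i c zeta i' :
    (c *: single i zeta) i' = if i' == i then c *: zeta else 0.
  transitivity (c *: single i zeta i'); first by [].
  by rewrite /single; case: eqP => // _; rewrite scaler0.
have /choice[G_ GE] : forall i, exists Gi : Q,
    forall x, Gi x = g (single i (hpoly_eval m x)).
  move=> i; pose gi zeta := g (single i zeta).
  have [||gam [_ gamE]] :=
      @exists_bounded_functional R k (dual Q) gi (2 * D) (mulr_ge0 (ler0n _ 2) D0).
  - move=> c zeta xi; rewrite /gi -gL; congr g; apply/funext => i'.
    exact: singleP.
  - move=> zeta; apply: le_trans (gb _) _.
    rewrite ler_wpM2l ?mulr_ge0//; apply: max_norm_le; first exact: rnorm_ge0.
    by move=> i'; rewrite /single; case: eqP => // _; rewrite rnorm0 rnorm_ge0.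
  have [Gi GiE] := bidual_hpoly gam.
  by exists Gi => x; rewrite GiE gamE.
have g0 : g 0 = 0 by have := gL (-1) 0 0; rewrite scaler0 addr0 mulN1r addNr.
have gZ c f : g (c *: f) = c * g f by have := gL c f 0; rewrite g0 !addr0.
have gsum (c : J -> K) (zeta : J -> dual Q) :
    g (fun i => c i *: zeta i) = \sum_i c i * g (single i (zeta i)).
  have -> : (fun i => c i *: zeta i) = \sum_i c i *: single i (zeta i).
    apply/funext => i; rewrite fct_sumE (bigD1 i)//= big1 ?addr0.
      by rewrite singleZ eqxx.
    by move=> i' ii'; rewrite singleZ eq_sym (negbTE ii').
  by elim/big_rec2: _ => [//|i _ f _ <-]; rewrite gL.
(* Apply [g] to the family with [hpoly_eval m x] in position [j], 0 elsewhere. *)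
have qE j : q j = \sum_i a i j *: G_ i.
  apply/val_inj/funext => x.
  pose lam (j' : 'I_n) (_ : 'I_1) : K := (j' == j)%:R.
  have E j' : eval_comb (fun=> x) (lam j') = (j' == j)%:R *: hpoly_eval m x.
    by rewrite /eval_comb big_ord1.
  have := gG _ _ (ex_intro _ 1%N (conj (ltn0Sn 0)
    (ex_intro _ (fun _ _ => x) (ex_intro _ lam (conj erefl erefl))))).
  rewrite (_ : T _ = fun i => a i j *: hpoly_eval m x); last first.
    apply/funext => i; rewrite /T (bigD1 j)//= big1 ?addr0.
      by rewrite E eqxx scale1r.
    by move=> j' /negbTE j'j; rewrite E j'j scale0r scaler0.
  rewrite (bigD1 j)//= [X in _ + X]big1 ?addr0 => [|j' /negbTE j'j]; last first.
    by rewrite E j'j scale0r.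
  rewrite E eqxx scale1r hpoly_evalE gsum => qjx.
  apply: etrans (esym qjx) _; apply: etrans (esym (hpoly_sumE _ _ _ _)).
  by apply: eq_bigr => i _; rewrite -GE.
have -> : \sum_j z j (q j) = \sum_i T z i (G_ i).
  under eq_bigr do rewrite qE linear_sum.
  rewrite exchange_big/=; apply: eq_bigr => i _; rewrite /T op_sumE.
  by apply: eq_bigr => j _; rewrite linearZ.
apply: le_trans (rnorm_sum _ _ _) _.
apply: (@le_trans _ _ (\sum_i weak_lpnorm p z * rnorm (G_ i))).
  apply: ler_sum => i _; apply: le_trans (rnorm_op_le _ _) _.
  by rewrite ler_wpM2r ?rnorm_ge0//; exact: rnorm_lincomb_le.
rewrite -mulr_sumr mulrC ler_wpM2r ?weak_lpnorm_ge0//.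
(* It remains to bound the sum of the norms of the [G_ i]: up to a factor 2 it is
   the value of [g] at a family of evaluations at points of the unit ball. *)
have /choice[x xP] : forall i, exists x, rnorm x <= 1 /\ rnorm (G_ i) <= 2 * mag (G_ i x).
  by move=> i; rewrite rnorm_hpoly; apply: ball_norm_half; exact: hpoly_bounded.
apply: (@le_trans _ _ (2 * \sum_i mag (G_ i (x i)))).
  by rewrite mulr_sumr; apply: ler_sum => i _; case: (xP i).
have -> : 4 * D = 2 * (2 * D) by rewrite mulrA -natrM.
rewrite ler_pM2l//.
have [u uP] := choice (fun i => (exists2P _ _).1 (exists_phase (G_ i (x i) : K))).
have sE : of_real k (\sum_i mag (G_ i (x i))) =
    g (fun i => u i *: hpoly_eval m (x i)).
  rewrite of_real_sum gsum; apply: eq_bigr => i _.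
  by rewrite -GE; case: (uP i).
rewrite -[leLHS](@mag_of_real R k); last first.
  by apply: sumr_ge0 => i _; exact: rnorm_ge0.
rewrite sE; apply: le_trans (gb _) _; rewrite ler_piMr ?mulr_ge0//.
apply: max_norm_le => // i; rewrite rnormZ.
case: (uP i) (xP i) => ui _ [xi _].
rewrite mulr_ile1 ?rnorm_ge0//; apply: le_trans (rnorm_hpoly_eval _ _) _.
by rewrite exprn_ile1 ?rnorm_ge0.
Qed.

End evaluation_combinations.

(** * Factorable strongly summing polynomials *)

Section factorable_polynomial.
Variables (R : realType) (k : scalar_kind) (p : R).
Hypothesis p1 : 1 <= p.
Local Notation K := (scalars R k).
Local Notation mag := (@rnorm R k K^o).
Variables (m : nat) (X Y : normedModType K) (P : hpoly m X Y).
Local Notation Q := (scalar_hpoly m X).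
Local Notation Ptt := (transpose (poly_transpose P)).

(** The bitranspose of [P] maps [eval_comb x lam] to [\sum_l lam l *: P (x l)],
    seen in the bidual of [Y]. *)
Lemma functional_eval_comb (psi : dual Y) n (x : 'I_n -> X) (lam : 'I_n -> K) :
  eval_comb m x lam (poly_transpose P psi) = psi (\sum_l lam l *: P (x l)).
Proof.
rewrite eval_combE linear_sum/=; apply: eq_bigr => l _.
by rewrite linearZ.
Qed.

(** The right-hand side of the inequality for factorable strongly summing
    polynomials is a weak norm. *)
Lemma weak_lpnorm_eval_comb n l (x : 'I_n -> 'I_l -> X) (lam : 'I_n -> 'I_l -> K) :
  sup [set lpnorm p (fun j =>
      @rnorm R k K^o (\sum_(i < l) lam j i *: q (x j i))) |
    q in [set q : Q | rnorm q <= 1]] =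
  weak_lpnorm p (fun j => eval_comb m (x j) (lam j)).
Proof.
rewrite /weak_lpnorm.
apply: (congr1 sup).
apply: eq_imagel => q _.
suff -> : (fun j => mag (\sum_(i < l) lam j i *: q (x j i))) =
          (fun j => mag (eval_comb m (x j) (lam j) q)) by [].
apply/funext => j.
by rewrite eval_combE.
Qed.

Lemma absolutely_summing_factorable :
  absolutely_summing p Ptt -> factorable_strongly_summing p P.
Proof.
move=> [C C0 uC]; exists C => // m1 m2 _ _ x lam.
pose z j := eval_comb m (x j) (lam j).
have Pz j : rnorm (\sum_i lam j i *: P (x j i)) <= rnorm (Ptt (z j)).
  have [psi [psi1 psiE]] := exists_norming_functional (\sum_i lam j i *: P (x j i)).
  rewrite -[leLHS](@mag_of_real R k) ?rnorm_ge0// -psiE -functional_eval_comb.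
  apply: le_trans (rnorm_op_le (Ptt (z j)) psi) _.
  by rewrite ler_piMr ?rnorm_ge0.
apply: (@le_trans _ _ (lpnorm p (fun j => rnorm (Ptt (z j))))).
  by apply: ler_lpnorm => // j; exact: rnorm_ge0.
apply: le_trans (uC _ z) _.
by rewrite [X in C * X <= _](weak_lpnorm_bidual p1 z) -weak_lpnorm_eval_comb.
Qed.

Lemma factorable_absolutely_summing :
  factorable_strongly_summing p P -> absolutely_summing p Ptt.
Proof.
move=> [C C0 PC]; exists (8 * C); first by rewrite mulr_ge0.
move=> n z; rewrite [X in _ * X](weak_lpnorm_bidual p1 z).
(* The empty family: its ell_p norm is 0 since [p^-1] is not 0. *)
have [n_0|n0] := posnP n.
  rewrite big1 => [|[j jn] _]; last by have := jn; rewrite {1}n_0.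
  rewrite powR0 ?invr_neq0 ?lt0r_neq0 ?(lt_le_trans ltr01)//.
  by rewrite !mulr_ge0// weak_lpnorm_ge0.
have /choice[psi psiP] : forall j, exists psi : dual Y,
    rnorm psi <= 1 /\ rnorm (Ptt (z j)) <= 2 * mag (Ptt (z j) psi).
  by move=> j; rewrite rnorm_op; apply: ball_norm_half; exact: bounded_op_bounded.
pose w j : K := z j (poly_transpose P (psi j)).
have [b ble bw] := lpnorm_norming p1 w.
pose q j : Q := b j *: poly_transpose P (psi j).
have -> : 8 * C = 2 * (4 * C) by rewrite mulrA -natrM.
(* A factor 2 for the choice of the [psi j] and 4 from the extension to arbitrary
   functionals. *)
apply: (@le_trans _ _ (2 * lpnorm p (fun j => mag (w j)))).
  rewrite -lpnormZ//; last by move=> j; exact: rnorm_ge0.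
  by apply: ler_lpnorm => // j; [exact: rnorm_ge0|case: (psiP j)].
rewrite -mulrA ler_pM2l// -[leLHS](@mag_of_real R k) ?powR_ge0// -bw.
have -> : \sum_j b j * w j = \sum_j z j (q j).
  by apply: eq_bigr => j _; rewrite /q linearZ.
apply: eval_comb_bound_bidual => // l l0 x lam.
rewrite -weak_lpnorm_eval_comb; apply: le_trans (PC n l n0 l0 x lam).
have -> : \sum_j eval_comb m (x j) (lam j) (q j) =
    \sum_j b j * psi j (\sum_i lam j i *: P (x j i)).
  by apply: eq_bigr => j _; rewrite /q linearZ/= -functional_eval_comb.
apply: le_trans (ble _) _; apply: ler_lpnorm => // j; first exact: rnorm_ge0.
apply: le_trans (rnorm_op_le _ _) _; case: (psiP j) => psi1 _.
by rewrite ler_piMl ?rnorm_ge0.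
Qed.

End factorable_polynomial.

Theorem proposition5p12 (R : realType) (k : scalar_kind) (p : R) (m : nat)
    (X Y : completeNormedModType (scalars R k)) (P : hpoly m X Y) :
  1 <= p -> (1 <= m)%N ->
  factorable_strongly_summing p P <->
  absolutely_summing p (transpose (poly_transpose P)).
Proof.
move=> p1 _; split.
  exact: factorable_absolutely_summing.
exact: absolutely_summing_factorable.
Qed.
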